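(* Let $k\ge1$, let $\gamma\in\mathbb{R}\setminus\{0,-1,-2,\dots\}$, let $\lambda_1,\dots,\lambda_k$ be distinct non-zero real numbers, and let ${\bf F_{k,\gamma}}=\{F_\gamma(x;\lambda_j)\}_{j=1}^k$, where $F_\gamma(x;\lambda)=\sum_{l=0}^\infty\frac{\lambda^l}{(\gamma)_l}T_l(x)$. For a multi-index $(n,\overrightarrow m)\in\mathbb{Z}_+^{k+1}$, $\overrightarrow m=(m_1,\dots,m_k)\ne(0,\dots,0)$, satisfying the condition $n\ge m_j$ $(j=1,2,\dots,k)$, for all $n$, starting from some $n_0$, there exist nonlinear Hermite--Chebyshev approximations $\{\widehat\pi^{ch}_j(x;{\bf F_{k,\gamma}})\}_{j=1}^k$, and with the appropriate normalization the following representations of their denominator are valid: $$\widehat Q^{ch}_m(x;{\bf F_{k,\gamma}})=Q_m(e^{i\arccos x};{\bf E_{k,\gamma}})\cdot\overline{Q_m(e^{i\arccos x};{\bf E_{k,\gamma}})}=\frac{1}{\Gamma^2(n+m+\gamma)}\left|\int_0^{+\infty}U_\gamma(t)e^{-t(x+i\sqrt{1-x^2})}\,dt\right|^2.$$ If, in addition, $0<\lambda_1<\lambda_2<\dots<\lambda_k$, then among $\{\widehat\pi^{ch}_j(x;{\bf F_{k,\gamma}})\}_{j=1}^k$ there is a nonlinear Hermite--Chebyshev approximation $\widehat\pi^{ch}_j(x;{\bf F_{k,\gamma}})$ that is not a linear Hermite--Chebyshev approximation $\pi^{ch}_j(x;{\bf F_{k,\gamma}})$.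
   Context: $\mathbb{Z}_+$ denotes the non-negative integers, $m=m_1+\dots+m_k$, $n_j=n+m-m_j$, $T_l(x)=\cos(l\arccos x)$ are the Chebyshev polynomials, $(\gamma)_0=1$, $(\gamma)_p=\gamma(\gamma+1)\cdots(\gamma+p-1)$, and $\Gamma$ is Euler's gamma function. The function $U_\gamma(t)=t^{n+\gamma-1}\prod_{p=1}^k(t-\lambda_p)^{m_p}$. The system ${\bf E_{k,\gamma}}=\{E_\gamma(\lambda_jz)\}_{j=1}^k$, where $E_\gamma(z)=\sum_{p=0}^\infty z^p/(\gamma)_p$. $Q_m(z;{\bf E_{k,\gamma}})$ denotes the (algebraic) Hermite--Padé denominator of this system for $(n,\overrightarrow m)$: a polynomial $Q_m\not\equiv0$ of degree at most $m$ for which there are polynomials $P^j_{n_j}$ with $\deg P^j_{n_j}\le n_j$ and $Q_m(z)E_\gamma(\lambda_jz)-P^j_{n_j}(z)=O(z^{n+m+1})$ for $j=1,\dots,k$ (a power series starting with the power $z^{n+m+1}$), normalized by $Q_m(0)=1$ (for $n\ge m_j-1$, $j=1,\dots,k$, such a solution is unique up to a factor and can be so normalized). For a system ${\bf f^{ch}}=(f^{ch}_1,\dots,f^{ch}_k)$ of functions represented by series in Chebyshev polynomials with real coefficients: Nonlinear Hermite--Chebyshev approximations for $(n,\overrightarrow m)$ and ${\bf f^{ch}}$ are rational functions $\widehat\pi^{ch}_j(x;{\bf f^{ch}})=\widehat P^{ch}_j(x)/\widehat Q^{ch}_m(x)$, $j=1,\dots,k$, with $\widehat Q^{ch}_m=\sum_{p=0}^m\widehat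 u_pT_p$, $\widehat P^{ch}_j=\sum_{p=0}^{n_j}\widehat v^j_pT_p$, such that $f^{ch}_j(x)-\widehat P^{ch}_j(x)/\widehat Q^{ch}_m(x)=\sum_{l=n+m+1}^\infty\widehat a^j_lT_l(x)$ for $j=1,\dots,k$. Linear Hermite--Chebyshev approximations for $(n,\overrightarrow m)$ and ${\bf f^{ch}}$ are fractions $\pi^{ch}_j(x;{\bf f^{ch}})=P^{ch}_j(x)/Q^{ch}_m(x)$, $j=1,\dots,k$, with $Q^{ch}_m=\sum_{p=0}^mu_pT_p\not\equiv0$, $P^{ch}_j=\sum_{p=0}^{n_j}v^j_pT_p$ (complex coefficients), such that $Q^{ch}_m(x)f^{ch}_j(x)-P^{ch}_j(x)=\sum_{l=n+m+1}^\infty\tilde a^j_lT_l(x)$ for $j=1,\dots,k$.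
   Formalization: The integral representation of the denominator is stated only for 0 < x ≤ 1, because for x ≤ 0 (and large n) the integral of U_γ(t)e^{-t(x+i√(1-x²))} over (0,+∞) diverges; the representation by Q_m is stated for all x in [-1,1]. *)

(* Defs.v *)
From HB Require Import structures.
From mathcomp Require Import all_boot all_order all_algebra.
From mathcomp Require Import complex.
From mathcomp Require Import all_classical all_reals all_analysis.
Set Implicit Arguments.
Unset Strict Implicit.
Unset Printing Implicit Defensive.
Import Order.TTheory GRing.Theory Num.Theory.
Import numFieldNormedType.Exports.
Local Open Scope classical_set_scope.
Local Open Scope ring_scope.
Local Open Scope complex_scope.

Section ComplexAnalysis.
Context {R : realType}.
Implicit Types (D : set R) (f : R -> R[i]) (z : R[i]).

Definition cexp z : R[i] :=
  (expR (complex.Re z))%:C * (cos (complex.Im z) +i* sin (complex.Im z)).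

(* R[i] carries no canonical topology: sums of series and integrals are taken
   componentwise. *)
Definition cseries_sum (a : nat -> R[i]) (s : R[i]) : Prop :=
  series (fun l => complex.Re (a l)) @ \oo --> complex.Re s /\
  series (fun l => complex.Im (a l)) @ \oo --> complex.Im s.

Definition cintegrable D f : Prop :=
  lebesgue_measure.-integrable D (fun t => (complex.Re (f t))%:E) /\
  lebesgue_measure.-integrable D (fun t => (complex.Im (f t))%:E).

Definition cintegral D f : R[i] :=
  Rintegral lebesgue_measure D (fun t => complex.Re (f t)) +i*
  Rintegral lebesgue_measure D (fun t => complex.Im (f t)).

End ComplexAnalysis.

Section SpecialFunctions.
Context {R : realType}.
Implicit Types (g lam x t s : R).

(* Euler's integral, meaningful for 0 < s only. *)
Definition Gamma s : R :=
  Rintegral lebesgue_measure `]0, +oo[ (fun t => t `^ (s - 1) * expR (- t)).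

Definition poch g (p : nat) : R := \prod_(i < p) (g + i%:R).

(* Taylor coefficients at 0 of z |-> E_g(lam z). *)
Definition coefE g lam (p : nat) : R := lam ^+ p / poch g p.

(* Only used for x in [-1, 1], as are all Chebyshev expansions below. *)
Definition chebT (l : nat) x : R := cos (l%:R * acos x).

Definition F g lam x : R :=
  limn (series (fun l => coefE g lam l * chebT l x)).

End SpecialFunctions.

Section MultiIndex.
Context {k : nat}.
Implicit Types (n : nat) (m : 'I_k -> nat).

Definition mtot m : nat := (\sum_(i < k) m i)%N.

(* The subtraction never truncates, since m j <= mtot m. *)
Definition nj n m (j : 'I_k) : nat := (n + mtot m - m j)%N.

End MultiIndex.

Section HermitePade.
Context {R : realType} {k : nat}.
Implicit Types (phi : 'I_k -> nat -> R[i]) (n : nat) (m : 'I_k -> nat).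

(* The system is given by the coefficient sequences phi j of its power series;
   the sum below is the l-th coefficient of the product of Q and the j-th
   series. *)
Definition HP_denominator phi n m (Q : {poly R[i]}) : Prop :=
  [/\ Q != 0, (size Q <= (mtot m).+1)%N &
      forall j, exists P : {poly R[i]}, (size P <= (nj n m j).+1)%N /\
        forall l, (l < n + mtot m + 1)%N ->
          \sum_(p < l.+1) Q`_p * phi j (l - p)%N - P`_l = 0].

Definition normalized_HP_denominator phi n m (Q : {poly R[i]}) : Prop :=
  HP_denominator phi n m Q /\ Q.[0] = 1.

Definition sysE (g : R) (lam : 'I_k -> R) (j : 'I_k) (p : nat) : R[i] :=
  (coefE g (lam j) p)%:C.

Definition sysF (g : R) (lam : 'I_k -> R) (j : 'I_k) (x : R) : R :=
  F g (lam j) x.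

Definition U (g : R) (lam : 'I_k -> R) n m (t : R) : R :=
  t `^ (n%:R + g - 1) * \prod_(p < k) (t - lam p) ^+ m p.

End HermitePade.

Section HermiteChebyshev.
Context {R : realType} {k : nat}.
Implicit Types (f : 'I_k -> R -> R) (n : nat) (m : 'I_k -> nat).
Implicit Types (u : nat -> R[i]) (v : 'I_k -> nat -> R[i]).

Definition chebsum (d : nat) u (x : R) : R[i] :=
  \sum_(p < d.+1) u p * (chebT p x)%:C.

Definition cheb_tail (N : nat) (h : R -> R[i]) : Prop :=
  exists a : nat -> R[i], forall x : R, -1 <= x <= 1 ->
    cseries_sum (fun l => a (N + l)%N * (chebT (N + l) x)%:C) (h x).

(* u, v are the coefficients of the denominator and of the numerators.  The
   denominator may not vanish on [-1, 1], so that the quotient is a genuine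
   one there (in R[i], z / 0 = 0). *)
Definition nonlinear_HCh f n m u v : Prop :=
  (forall x : R, -1 <= x <= 1 -> chebsum (mtot m) u x != 0) /\
  forall j, cheb_tail (n + mtot m + 1) (fun x =>
    (f j x)%:C - chebsum (nj n m j) (v j) x / chebsum (mtot m) u x).

Definition linear_HCh f n m u v : Prop :=
  (exists2 p, (p <= mtot m)%N & u p != 0) /\
  forall j, cheb_tail (n + mtot m + 1) (fun x =>
    chebsum (mtot m) u x * (f j x)%:C - chebsum (nj n m j) (v j) x).

(* Equality of v j / u and v' j / u' as rational functions: a linear
   denominator may have zeros on [-1, 1], hence the cross-multiplied form. *)
Definition same_fraction n m (j : 'I_k) u v u' v' : Prop :=
  forall x : R, -1 <= x <= 1 ->
    chebsum (nj n m j) (v j) x * chebsum (mtot m) u' x =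
    chebsum (nj n m j) (v' j) x * chebsum (mtot m) u x.

End HermiteChebyshev.

(* Main.v *)
(* With w(t) = \prod_p (t - lam_p)^(m_p), the Hermite-Pade conditions at lam_j
   say that products of operators b + t d/dt applied to the polynomial with
   coefficients Q_(M-p) (g)_(n+M) / (g)_(n+p) vanish at lam_j; hence this
   polynomial is w, which determines Q and gives Q(e^(i theta)) as a Laplace
   transform of U_g along a ray.

   For large n the coefficients of Q of positive index sum to at most 1/2 in
   modulus, so E_g(lam_j z) - P_j(z)/Q(z) is an absolutely convergent power
   series on the unit circle starting at z^(n+M+1); its real part is the
   nonlinear remainder, with denominator |Q|^2.

   If lam_j is the smallest node with m_j <> 0, the first coefficient of this
   remainder is a nonzero multiple of \int_0^(lam_j) U_g.  Were the fraction
   linear, the linear remainder would be the nonlinear one times the linear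
   denominator, of degree d say, so the two expansions would disagree at
   T_(n+M+1-d) if d > 0, and F_j would have a gap at T_(n+M) if d = 0.
   Expansions in T_l that merely converge pointwise are compared by Cantor's
   uniqueness theorem. *)

Require Import Defs.
From HB Require Import structures.
From mathcomp Require Import all_boot all_order all_algebra.
From mathcomp Require Import complex.
From mathcomp Require Import all_classical all_reals all_analysis.
From mathcomp Require Import measurable_realfun ring lra zify.
Set Implicit Arguments.
Unset Strict Implicit.
Unset Printing Implicit Defensive.
Import Order.TTheory GRing.Theory Num.Theory.
Import numFieldNormedType.Exports.
Local Open Scope classical_set_scope.
Local Open Scope ring_scope.
Local Open Scope complex_scope.

(** [cheb_tail] grants only pointwise convergence with unknown coefficients, so those of a linear
    remainder cannot be found by termwise integration; hence a uniqueness theorem as strong as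
    Cantor's. Convergence at every angle, 0 included, bounds the coefficients at once.

    Rotating the path of the Laplace integral is replaced by two real-variable facts on J_a =
    \int_0^oo t^a exp(- t e^(i th)) dt. Integration by parts reduces every J_(a+p) to J_a, and
    differentiation in th shows that |J_a| keeps its value Gamma(a + 1) at th = 0. The argument of
    J_a drops out, as only the squared modulus of the integral is wanted.

    The condition m_j <= n acts twice: it keeps the shift n - i in the Euler operators from going
    negative, and it gives M <= n_j, so that Re(P_j conj(Q)) has degree at most n_j in cosines. The
    bound 1/2 also acts twice: Q has no zero on the unit circle, and dividing by Q preserves
    absolute convergence. *)

Section PointwiseDerivatives.
Variable R : realType.
Implicit Types (f g : R -> R) (x a b c : R).

Lemma is_derive_cstE c x : is_derive x 1 (fun=> c) 0.
Proof. exact: is_derive_cst. Qed.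

Lemma is_derive_idE x : is_derive x 1 (fun y : R => y) 1.
Proof. exact: is_derive_id. Qed.

Lemma is_deriveDE f g x a b : is_derive x 1 f a -> is_derive x 1 g b ->
  is_derive x 1 (fun y => f y + g y) (a + b).
Proof. by move=> df dg; exact: is_deriveD. Qed.

Lemma is_deriveNE f x a : is_derive x 1 f a -> is_derive x 1 (fun y => - f y) (- a).
Proof. by move=> df; exact: is_deriveN. Qed.

Lemma is_deriveME f g x a b : is_derive x 1 f a -> is_derive x 1 g b ->
  is_derive x 1 (fun y => f y * g y) (a * g x + f x * b).
Proof.
move=> df dg; eapply is_derive_eq; first exact: is_deriveM.
by rewrite /GRing.scale /= addrC [g x * a]mulrC.
Qed.

Lemma is_derive1_compE f g x a b : is_derive (g x) 1 f a -> is_derive x 1 g b ->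
  is_derive x 1 (fun y => f (g y)) (a * b).
Proof. by move=> df dg; exact: (is_derive1_comp df dg). Qed.

Lemma is_derive_expRE g x b : is_derive x 1 g b ->
  is_derive x 1 (fun y => expR (g y)) (expR (g x) * b).
Proof. by move=> dg; apply: is_derive1_compE. Qed.

Lemma is_derive_sinE g x b : is_derive x 1 g b ->
  is_derive x 1 (fun y => sin (g y)) (cos (g x) * b).
Proof. by move=> dg; apply: is_derive1_compE. Qed.

Lemma is_derive_cosE g x b : is_derive x 1 g b ->
  is_derive x 1 (fun y => cos (g y)) (- sin (g x) * b).
Proof. by move=> dg; apply: is_derive1_compE. Qed.

Lemma is_deriveVE f x a : f x != 0 -> is_derive x 1 f a ->
  is_derive x 1 (fun y => (f y)^-1) (- (f x) ^- 2 * a).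
Proof. by move=> fx df; exact: is_deriveV. Qed.

Lemma is_derive_sumE I (r : seq I) (h : I -> R -> R) (dh : I -> R) x :
  (forall i, is_derive x 1 (h i) (dh i)) ->
  is_derive x 1 (fun y => \sum_(i <- r) h i y) (\sum_(i <- r) dh i).
Proof.
move=> dhi; elim: r => [|i r IH].
  by rewrite big_nil; under eq_fun do rewrite big_nil; exact: is_derive_cstE.
by rewrite big_cons; under eq_fun do rewrite big_cons; exact: is_deriveDE.
Qed.

Lemma is_derive_continuous f x a : is_derive x 1 f a -> {for x, continuous f}.
Proof. by move=> df; apply/differentiable_continuous/derivable1_diffP. Qed.

End PointwiseDerivatives.

Ltac derive1_rules := repeat first
  [ exact: is_derive_cstE | exact: is_derive_idE
  | apply: is_deriveDE | apply: is_deriveNE | apply: is_deriveME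
  | apply: is_derive_expRE | apply: is_derive_sinE | apply: is_derive_cosE ].

(** * Convergence of series and mean value bounds *)

Section Sequences.
Variable R : realType.
Implicit Types (u v : nat -> R) (l C : R).

Lemma seriesE u n : series u n = \sum_(i < n) u i.
Proof. by rewrite /series /= big_mkord. Qed.

Lemma lim_norm_le u l C : u @ \oo --> l -> (\forall n \near \oo, `|u n| <= C) ->
  `|l| <= C.
Proof.
move=> ul uC; have H : `|u n| @[n --> \oo] --> `|l| by exact: cvg_norm.
rewrite -(cvg_lim (@Rhausdorff R) H); apply: limr_le => //.
by apply/cvg_ex; exists `|l|.
Qed.

Lemma cvgn_series_bounded u C : (forall n, \sum_(i < n) `|u i| <= C) ->
  cvgn (series u).
Proof.
move=> uC; apply: normed_cvg; apply: nondecreasing_is_cvgn.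
  by apply: nondecreasing_series => i _ _; exact: normr_ge0.
exists C => _ [n _ <-]; by rewrite /= seriesE.
Qed.

Lemma nondecreasing_cvgn_bound v l n : (forall i, 0 <= v i) ->
  series v @ \oo --> l -> \sum_(i < n) v i <= l.
Proof.
move=> v0 vl; rewrite -seriesE -(cvg_lim (@Rhausdorff R) vl).
apply: nondecreasing_cvgn_le; last by apply/cvg_ex; exists l.
by apply: nondecreasing_series.
Qed.

Lemma cvg_sumE I (r : seq I) (T : Type) (Fl : set_system T) {FF : Filter Fl}
  (f : I -> T -> R) (l : I -> R) : (forall i, f i @ Fl --> l i) ->
  (fun n => \sum_(i <- r) f i n) @ Fl --> \sum_(i <- r) l i.
Proof.
move=> fl; elim: r => [|i r IH].
  by rewrite big_nil; under eq_fun do rewrite big_nil; exact: cvg_cst.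
by rewrite big_cons; under eq_fun do rewrite big_cons; exact: cvgD.
Qed.

Lemma is_derive_lip (f df : R -> R) C (a b : R) : a <= b ->
  (forall x, x \in `[a, b] -> is_derive x 1 f (df x)) ->
  (forall x, x \in `[a, b] -> `|df x| <= C) -> `|f b - f a| <= C * (b - a).
Proof.
move=> ab dF dC.
have Hd x : x \in `]a, b[ -> is_derive x 1 f (df x).
  by move=> xab; apply: dF; apply: subset_itv_oo_cc xab.
have Hc : {within `[a, b], continuous f}.
  by apply: derivable_within_continuous => x xab; have := dF x xab; case.
have [c cab E] := MVT_segment ab Hd Hc.
rewrite E normrM [X in _ * X]ger0_norm ?subr_ge0 //.
by apply: ler_wpM2r; rewrite ?subr_ge0 // dC.
Qed.

Lemma sin_lip (a b : R) : `|sin a - sin b| <= `|a - b|.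
Proof.
wlog ba : a b / b <= a.
  by move=> H; case: (leP b a) => [/H//|/ltW/H]; rewrite distrC [X in _ <= X]distrC.
rewrite [X in _ <= X]ger0_norm ?subr_ge0 // -[X in _ <= X]mul1r.
apply: (@is_derive_lip sin cos) => // x _.
exact: cos_max.
Qed.

Lemma cos_lip (a b : R) : `|cos a - cos b| <= `|a - b|.
Proof.
wlog ba : a b / b <= a.
  by move=> H; case: (leP b a) => [/H//|/ltW/H]; rewrite distrC [X in _ <= X]distrC.
rewrite [X in _ <= X]ger0_norm ?subr_ge0 // -[X in _ <= X]mul1r.
apply: (@is_derive_lip cos (fun x => - sin x)) => // x _.
by rewrite normrN; exact: sin_max.
Qed.

End Sequences.

(** * The Hermite-Pade denominator *)

Section Euler.
Variable K : numFieldType.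
Implicit Types (p q : {poly K}) (b x : K).

(** Monomials are eigenvectors: X^i has eigenvalue b + i. Consecutive values of [b] therefore
    produce quotients of rising factorials. *)
Definition euler b p : {poly K} := b *: p + 'X * p^`().

Lemma coef_euler b p i : (euler b p)`_i = (b + i%:R) * p`_i.
Proof.
rewrite /euler coefD coefZ coefXM mulrDl; congr (_ + _).
case: i => [|i] /=; first by rewrite mul0r.
by rewrite coef_deriv mulr_natl.
Qed.

Lemma coef_foldr_euler (bs : seq K) p i :
  (foldr euler p bs)`_i = \prod_(b <- bs) (b + i%:R) * p`_i.
Proof.
elim: bs => [|b bs IH] /=; first by rewrite big_nil mul1r.
by rewrite coef_euler IH big_cons mulrA.
Qed.

(** Each operator lowers the order of the zero at [x] by one. On (X - x)^(e+1) r it leaves (X - x)^e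
    times a factor with value x (e+1) r(x) at [x], whatever [b] is, because the summand with [b]
    keeps the full order. *)
Lemma horner_foldr_euler (bs : seq K) x q :
  (foldr euler (('X - x%:P) ^+ size bs * q) bs).[x] =
  (size bs)`!%:R * x ^+ size bs * q.[x].
Proof.
(* A surplus order [e] is carried along so that the induction can peel off one operator; [e = 0] is
   the claim. *)
suff H bs' e : exists r : {poly K},
    foldr euler (('X - x%:P) ^+ (size bs' + e) * q) bs' =
      ('X - x%:P) ^+ e * r /\
    r.[x] = ((size bs' + e) ^_ (size bs'))%:R * x ^+ size bs' * q.[x].
  have [r [h1 h2]] := H bs 0%N.
  by rewrite addn0 in h1 h2; rewrite h1 expr0 mul1r h2 ffactnn.
elim: bs' e => [|b bs' IH] e /=.
  by exists q; rewrite add0n ffactn0 expr0 !mul1r.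
have [r [h1 h2]] := IH e.+1.
rewrite addSnnS h1.
exists (b *: (('X - x%:P) * r) + 'X * (r *+ e.+1 + ('X - x%:P) * r^`())); split.
  rewrite /euler derivM deriv_exp derivXsubC /= mul1r.
  rewrite -!mul_polyC exprS -[_ *+ e.+1]mulr_natl -[r *+ _]mulr_natl; ring.
have -> : (b *: (('X - x%:P) * r) + 'X * (r *+ e.+1 + ('X - x%:P) * r^`())).[x] =
    x * (r.[x] *+ e.+1).
  by rewrite !(hornerD, hornerZ, hornerM, hornerMn, hornerX, hornerXsubC) hornerN hornerC
    subrr !(mul0r, mulr0) add0r addr0.
rewrite h2.
rewrite ffactnSr exprS.
have -> : (size bs' + e.+1 - size bs' = e.+1)%N by rewrite addKn.
rewrite natrM -mulr_natl; ring.
Qed.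

(** Only the number of operators counts, so the list may change with [i], as it does in the
    Hermite-Pade conditions. Once the zero has order i, the i-th condition reads i! x^i q(x) = 0,
    and [x != 0] turns it into one more factor. *)
Lemma dvdp_euler (x : K) (x0 : x != 0) (bs : nat -> seq K) e p :
  (forall i, (i < e)%N -> size (bs i) = i) ->
  ('X - x%:P) ^+ e %| p <->
  (forall i, (i < e)%N -> (foldr euler p (bs i)).[x] = 0).
Proof.
move=> sz; split.
  move=> /dvdpP[q ->] i ie; rewrite mulrC -(subnKC (ltnW ie)) exprD -mulrA.
  rewrite -[X in ('X - _) ^+ X * _](sz i ie) horner_foldr_euler hornerM horner_exp.
  by rewrite hornerXsubC subrr sz // expr0n subn_eq0 leqNgt ie /= mul0r mulr0.
elim: e sz => [|e IH] sz h; first by rewrite expr0 dvd1p.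
have /dvdpP[q pq] : ('X - x%:P) ^+ e %| p.
  by apply: IH => i ie; [exact/sz/ltnW|exact/h/ltnW].
have := h e (ltnSn e); rewrite pq mulrC -[X in ('X - _) ^+ X * _](sz e (ltnSn e)).
rewrite horner_foldr_euler => /eqP.
rewrite !mulf_eq0 pnatr_eq0 sz // eqn0Ngt fact_gt0 /=.
rewrite expf_eq0 (negbTE x0) andbF /= => /eqP qx.
have /factor_theorem[r ->] : root q x by apply/rootP.
by rewrite exprSr dvdp_mul // dvdp_mull.
Qed.

End Euler.

Section HermitePadeAlgebra.
Variables (K : numFieldType) (k : nat) (g : K) (lam : 'I_k -> K).
Variables (m : 'I_k -> nat) (n : nat).
Hypothesis g_ok : forall p : nat, g != - p%:R.
Hypothesis lam_inj : injective lam.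
Hypothesis lam_neq0 : forall j, lam j != 0.
Hypothesis m_le : forall j, (m j <= n)%N.
Implicit Types Q : {poly K}.

Definition rising (x : K) (l : nat) : K := \prod_(i < l) (x + i%:R).

Lemma rising_neq0 l : rising g l != 0.
Proof. by apply/prodf_neq0 => i _; rewrite addr_eq0 g_ok. Qed.

Lemma risingD x a b : rising x (a + b) = rising x a * rising (x + a%:R) b.
Proof.
rewrite /rising big_split_ord /=; congr (_ * _).
by apply: eq_bigr => i _; rewrite natrD addrA.
Qed.

Definition nodal : {poly K} := \prod_(j < k) ('X - (lam j)%:P) ^+ m j.

Lemma nodal_monic : nodal \is monic.
Proof. by apply: monic_prod => j _; rewrite monic_exp ?monicXsubC. Qed.

Lemma size_nodal : size nodal = (mtot m).+1.
Proof.
rewrite /nodal size_prod; last by move=> j _; rewrite expf_neq0 ?polyXsubC_eq0.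
under eq_bigr do rewrite size_exp_XsubC -addn1.
rewrite big_split /= sum_nat_const muln1 -addSn addnK //.
Qed.

Definition reverse_weight Q : {poly K} :=
  \poly_(p < (mtot m).+1) (Q`_(mtot m - p) * rising g (n + mtot m) / rising g (n + p)).

(** The solution of [reverse_weight Q = nodal], coefficient by coefficient; as [nodal] is monic, the
    constant coefficient comes out as 1. *)
Definition nodal_denominator : {poly K} :=
  \poly_(p < (mtot m).+1)
    (nodal`_(mtot m - p) * rising g (n + mtot m - p) / rising g (n + mtot m)).

(** Reindexing by p -> M - p. The range of [l] goes beyond the Hermite-Pade conditions because the
    order n + M + 1 serves for the first coefficient of the remainder. *)
Lemma sum_reverse_weight Q x l : (mtot m <= l)%N -> (size Q <= (mtot m).+1)%N ->
  \sum_(p < l.+1) Q`_p * (x ^+ (l - p) / rising g (l - p)) =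
  (rising g (n + mtot m))^-1 * \sum_(p < (mtot m).+1)
    (reverse_weight Q)`_p * x ^+ (l - mtot m + p) *
     (rising g (n + p) / rising g (l - mtot m + p)).
Proof.
move=> ml sQ.
transitivity (\sum_(p < (mtot m).+1) Q`_p * (x ^+ (l - p) / rising g (l - p))).
  rewrite [RHS](big_ord_widen l.+1 (fun p => Q`_p * (x ^+ (l - p) / rising g (l - p)))) //.
  rewrite [LHS](bigID (fun i : 'I_l.+1 => i < (mtot m).+1)%N) /= [X in _ + X]big1 ?addr0 // => i.
  rewrite -leqNgt => mi; rewrite nth_default ?mul0r //; exact: leq_trans sQ mi.
rewrite (reindex_inj rev_ord_inj) /= mulr_sumr; apply: eq_bigr => p _.
rewrite coef_poly ltn_ord subSS.
have -> : (l - (mtot m - p) = l - mtot m + p)%N by have := ltn_ord p; lia.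
have := rising_neq0 (n + mtot m); have := rising_neq0 (n + p).
have := rising_neq0 (l - mtot m + p); set a := rising _ _; set b := rising _ _.
by set c := rising _ _ => a0 b0 c0; field; rewrite a0 b0 c0.
Qed.

(** The quotient (g)_(n+p) / (g)_(n-i+p) is the product of the factors g + n - i + r + p, r < i,
    that is, the eigenvalue at X^p of [i] Euler operators. *)
Lemma sum_reverse_weight_euler Q x i : (i <= n)%N -> (size Q <= (mtot m).+1)%N ->
  \sum_(p < (n + mtot m - i).+1) Q`_p * (x ^+ (n + mtot m - i - p) / rising g (n + mtot m - i - p)) =
  (rising g (n + mtot m))^-1 * x ^+ (n - i) *
  (foldr (@euler K) (reverse_weight Q) [seq g + (n - i + r)%:R | r <- iota 0 i]).[x].
Proof.
move=> ile sQ; rewrite sum_reverse_weight //; last by lia.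
rewrite -mulrA; congr (_ * _).
have -> : (n + mtot m - i - mtot m = n - i)%N by lia.
have E : (size (foldr (@euler K) (reverse_weight Q)
   [seq (g + (n - i + r)%:R)%R | r <- iota 0 i]) <= (mtot m).+1)%N.
  apply/leq_sizeP => p mp; rewrite coef_foldr_euler coef_poly ltnNge mp /=.
  by rewrite mulr0.
rewrite (horner_coef_wide _ E) mulr_sumr; apply: eq_bigr => p _.
rewrite coef_foldr_euler big_map -[X in iota _ X]subn0 -/(index_iota 0 i) big_mkord exprD.
have -> : (n + p = n - i + p + i)%N by lia.
rewrite risingD [_ / _]mulrAC divff ?rising_neq0 // mul1r /rising.
under eq_bigr do rewrite -addrA -natrD.
under [in RHS]eq_bigr do rewrite -addrA -natrD addnAC.
ring.
Qed.

Lemma nodal_dvdp p : (forall j, ('X - (lam j)%:P) ^+ m j %| p) -> nodal %| p.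
Proof.
move=> h; rewrite /nodal.
suff : forall r : seq 'I_k, uniq r -> \prod_(j <- r) ('X - (lam j)%:P) ^+ m j %| p.
  by apply; rewrite index_enum_uniq.
elim=> [|j r IH] /=; first by rewrite big_nil dvd1p.
move=> /andP[jr ur]; rewrite big_cons Gauss_dvdp ?h ?IH //.
rewrite big_seq; elim/big_rec: _ => [|i q ir cq]; first exact: coprimep1.
rewrite coprimepMr cq andbT coprimep_expl // coprimep_expr //.
rewrite coprimep_XsubC root_XsubC; apply: contraNneq jr => /lam_inj <-.
exact: ir.
Qed.

(** The conditions at [lam j] are the orders n_j < l <= n + M, written l = n + M - i with
    [i < m j]. *)
Lemma reverse_weight_dvdP Q : (size Q <= (mtot m).+1)%N ->
  (forall j i, (i < m j)%N ->
   \sum_(p < (n + mtot m - i).+1) Q`_p *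
     (lam j ^+ (n + mtot m - i - p) / rising g (n + mtot m - i - p)) = 0) <->
  nodal %| reverse_weight Q.
Proof.
move=> sQ.
pose bs i := [seq g + (n - i + r)%:R | r <- iota 0 i].
have sbs i : size (bs i) = i by rewrite size_map size_iota.
have E j i : (i < m j)%N -> \sum_(p < (n + mtot m - i).+1) Q`_p *
     (lam j ^+ (n + mtot m - i - p) / rising g (n + mtot m - i - p)) = 0 <->
     (foldr (@euler K) (reverse_weight Q) (bs i)).[lam j] = 0.
  move=> ij; have ilen : (i <= n)%N by rewrite (leq_trans (ltnW ij)).
  rewrite sum_reverse_weight_euler //.
  split=> [/eqP|->]; last by rewrite mulr0.
  rewrite !mulf_eq0 invr_eq0 (negbTE (rising_neq0 _)) expf_eq0.
  by rewrite (negbTE (lam_neq0 _)) andbF => /eqP.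
split=> [h|h j i ij].
  apply: nodal_dvdp => j; apply/(dvdp_euler (lam_neq0 j) _ (fun i _ => sbs i)) => i ij.
  exact/E/h.
apply/E => //; move: i ij; apply/(dvdp_euler (lam_neq0 j) _ (fun i _ => sbs i)).
by apply: dvdp_trans h; rewrite /nodal (bigD1 j) //= dvdp_mulr.
Qed.

Lemma reverse_weight_nodal : reverse_weight nodal_denominator = nodal.
Proof.
apply/polyP => p; rewrite coef_poly; case: ltnP => [pm|mp]; last first.
  by rewrite nth_default // size_nodal.
rewrite coef_poly ltnS leq_subr subKn //.
have -> : (n + mtot m - (mtot m - p) = n + p)%N by lia.
have := rising_neq0 (n + mtot m); have := rising_neq0 (n + p).
by set a := rising _ _; set b := rising _ _ => a0 b0; field; rewrite a0 b0.
Qed.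

Lemma size_nodal_denominator : (size nodal_denominator <= (mtot m).+1)%N.
Proof. exact: size_poly. Qed.

Lemma nodal_denominator0 : nodal_denominator`_0 = 1.
Proof.
rewrite coef_poly /= subn0 subn0 -mulrA divff ?rising_neq0 // mulr1.
by have := monicP nodal_monic; rewrite lead_coefE size_nodal.
Qed.

(** By degrees the cofactor of [nodal] is a constant; it is 1 because the coefficient at M of the
    weighted reverse is Q_0. *)
Lemma nodal_denominator_unique Q : (size Q <= (mtot m).+1)%N -> Q`_0 = 1 ->
  nodal %| reverse_weight Q -> Q = nodal_denominator.
Proof.
move=> sQ Q0 /dvdpP[r rE].
have rm : (reverse_weight Q)`_(mtot m) = 1.
  by rewrite coef_poly leqnn subnn Q0 mul1r divff ?rising_neq0.
have r0 : r != 0.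
  by apply: contra_eq_neq rm => r0; rewrite rE r0 mul0r coef0 eq_sym oner_eq0.
have : size r = 1%N.
  have: (size (reverse_weight Q) <= (mtot m).+1)%N by exact: size_poly.
  rewrite rE size_Mmonic ?nodal_monic // size_nodal.
  by rewrite -size_poly_gt0 in r0; move: r0; move: (size r) => c; lia.
move=> /eqP/size_poly1P[c c0 rc].
have c1 : c = 1.
  move: rm; rewrite rE rc coefCM -[X in _`_X]/(mtot m).+1.-1 -size_nodal -lead_coefE.
  by rewrite (monicP nodal_monic) mulr1.
rewrite rc c1 mul1r in rE.
apply/polyP => p; rewrite coef_poly; case: ltnP => [pm|mp]; last first.
  by rewrite nth_default // (leq_trans sQ).
rewrite -rE coef_poly ltnS leq_subr subKn //.
have -> : (n + (mtot m - p) = n + mtot m - p)%N by lia.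
have := rising_neq0 (n + mtot m); have := rising_neq0 (n + mtot m - p).
by set a := rising _ _; set b := rising _ _ => a0 b0; field; rewrite a0 b0.
Qed.

End HermitePadeAlgebra.

(** * Cantor uniqueness theorem for cosine series *)

Section Sinc.
Variable R : realType.
Implicit Types (a b h x : R) (c s : nat -> R).

(** The left side is the numerator of the derivative of sin x / x, so this bound makes that quotient
    1-Lipschitz on the positive axis. *)
Lemma sub_sin_le x : 0 <= x -> `|x * cos x - sin x| <= x ^+ 2.
Proof.
move=> x0.
have H := @is_derive_lip R (fun y => y * cos y - sin y) (fun y => - (y * sin y)) x 0 x x0.
move: H; rewrite mul0r sin0 !subr0 -expr2; apply => y.
  move=> _; eapply is_derive_eq; first by derive1_rules.
  by rewrite /GRing.scale /=; ring.
rewrite in_itv /= => /andP[y0 yx]; rewrite normrN normrM (ger0_norm y0).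
by rewrite -[leRHS]mulr1 ler_pM // sin_max.
Qed.

Lemma sinc_lip a b : 0 < a -> a <= b -> `|sin b / b - sin a / a| <= b - a.
Proof.
move=> a0 ab; rewrite -[leRHS]mul1r.
apply: (@is_derive_lip R (fun y => sin y / y)
  (fun y => (y * cos y - sin y) / y ^+ 2)) => // y;
  rewrite in_itv /= => /andP[ay _]; have y0 := lt_le_trans a0 ay.
  eapply is_derive_eq.
    exact: (is_deriveME (is_derive_sin y) (is_deriveVE (lt0r_neq0 y0) (is_derive_idE y))).
  by rewrite /=; field; rewrite gt_eqF.
rewrite normrM normfV normrX (gtr0_norm y0) ler_pdivrMr ?exprn_gt0 // mul1r.
exact/sub_sin_le/ltW.
Qed.

Lemma sinc_le1 x : 0 < x -> `|sin x / x| <= 1.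
Proof.
move=> x0; rewrite normrM normfV (gtr0_norm x0) ler_pdivrMr // mul1r.
by have := sin_lip x 0; rewrite sin0 !subr0 (gtr0_norm x0).
Qed.

Lemma sinc_near1 h : 0 < h -> `|1 - sin h / h| <= h.
Proof.
move=> h0.
have -> : 1 - sin h / h = (h - sin h) / h by field; rewrite gt_eqF.
rewrite normrM normfV (gtr0_norm h0) ler_pdivrMr //.
have H := @is_derive_lip R (fun y => y - sin y) (fun y => 1 - cos y) h 0 h (ltW h0).
move: H; rewrite sin0 !subr0; apply => y.
rewrite in_itv /= => /andP[y0 yh]; apply: le_trans yh.
by have := cos_lip 0 y; rewrite cos0 sub0r normrN (ger0_norm y0).
Qed.

(* The multipliers of Riemann's second difference: (sin (l h) / (l h))^2, with
   the value 1 at l = 0 that division by zero does not give. *)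
Definition riemann_weight h (l : nat) : R :=
  if l == 0%N then 1 else (sin (l%:R * h) / (l%:R * h)) ^+ 2.

Lemma sqr_lip a b : `|a| <= 1 -> `|b| <= 1 -> `|a ^+ 2 - b ^+ 2| <= 2 * `|a - b|.
Proof.
move=> a1 b1; rewrite subr_sqr mulrC normrM; apply: ler_wpM2r => //.
by apply: le_trans (ler_normD _ _) _; lra.
Qed.

Lemma riemann_weight_le1 h l : 0 < h -> `|riemann_weight h l| <= 1.
Proof.
move=> h0; rewrite /riemann_weight; case: eqVneq => [_|l0]; first by rewrite normr1.
rewrite normrX expr_le1 //; apply: sinc_le1.
by rewrite mulr_gt0 // ltr0n lt0n.
Qed.

Lemma riemann_weight_step h l : 0 < h ->
  `|riemann_weight h l - riemann_weight h l.+1| <= 2 * h.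
Proof.
move=> h0; rewrite /riemann_weight /=; case: eqVneq => [->|l0].
  rewrite mul1r -{1}(expr1n _ 2); apply: le_trans (sqr_lip _ _) _.
  - by rewrite normr1.
  - exact: sinc_le1.
  - by rewrite ler_pM2l // sinc_near1.
have lh : 0 < l%:R * h by rewrite mulr_gt0 // ltr0n lt0n.
have le : l%:R * h <= l.+1%:R * h by rewrite ler_pM2r // ler_nat.
apply: le_trans (sqr_lip _ _) _.
- exact: sinc_le1.
- exact/sinc_le1/(lt_le_trans lh).
rewrite distrC ler_pM2l //; apply: le_trans (sinc_lip lh le) _.
by rewrite -natr1; lra.
Qed.

(** The uniform bound [2 * h] is not summable in l; here the first term is 2 / (l^2 h) and the
    second telescopes. *)
Lemma riemann_weight_step_far h l : 0 < h -> (0 < l)%N ->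
  `|riemann_weight h l - riemann_weight h l.+1| <=
  2 * h / (l%:R * h) ^+ 2 + ((l%:R * h) ^- 2 - (l.+1%:R * h) ^- 2).
Proof.
move=> h0 l0; rewrite /riemann_weight /= gtn_eqF //.
have : l.+1%:R * h = l%:R * h + h by rewrite -natr1; ring.
have : 0 < l%:R * h by rewrite mulr_gt0 // ltr0n.
set a := l%:R * h; set b := l.+1%:R * h => a0 bE.
have b0 : 0 < b by lra.
have -> : (sin a / a) ^+ 2 - (sin b / b) ^+ 2 =
  (sin a ^+ 2 - sin b ^+ 2) / a ^+ 2 + sin b ^+ 2 * (a ^- 2 - b ^- 2).
  by field; rewrite !gt_eqF.
have ab2 : 0 <= a ^- 2 - b ^- 2.
  rewrite subr_ge0 lef_pV2 ?posrE ?exprn_gt0 //.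
  by rewrite lerXn2r ?nnegrE; lra.
apply: le_trans (ler_normD _ _) _; apply: lerD.
  rewrite normrM normfV (ger0_norm (exprn_ge0 _ (ltW a0))) ler_pM2r ?invr_gt0 ?exprn_gt0 //.
  apply: le_trans (sqr_lip (sin_max _) (sin_max _)) _; rewrite ler_pM2l //.
  by apply: le_trans (sin_lip _ _) _; rewrite bE opprD addNKr normrN gtr0_norm.
rewrite normrM (ger0_norm ab2) -[leRHS]mul1r ler_wpM2r // normrX expr_le1 //.
exact: sin_max.
Qed.

(** Bounded variation uniformly in h = 1 / L: the first L steps give at most L (2 h) = 2, and after
    them the two parts of the far bound sum to at most 4 and 1. *)
Lemma riemann_weight_variation (L n : nat) : (0 < L)%N ->
  \sum_(l < n) `|riemann_weight L%:R^-1 l - riemann_weight L%:R^-1 l.+1| <= 7.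
Proof.
move=> L0; set h := L%:R^-1; have h0 : 0 < h by rewrite invr_gt0 ltr0n.
have LR : 0 < L%:R :> R by rewrite ltr0n.
have small p : (p <= L)%N ->
    \sum_(l < p) `|riemann_weight h l - riemann_weight h l.+1| <= 2.
  move=> pL; apply: (@le_trans _ _ (\sum_(l < p) 2 * h)).
    by apply: ler_sum => l _; exact: riemann_weight_step.
  rewrite sumr_const card_ord -[_ *+ p]mulr_natr -mulrA -[leRHS]mulr1 ler_pM2l //.
  by rewrite mulrC ler_pdivrMr // mul1r ler_nat.
case: (leqP n L) => [/small|Ln]; first by lra.
(* The telescoped form makes the induction close, by 2 L / x^2 <= 4 (L/x - L/(x+1)) for x >= 1. *)
suff H p : \sum_(l < (L + p)) `|riemann_weight h l - riemann_weight h l.+1| <=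
   2 + 4 * (1 - L%:R / (L + p)%:R) + (1 - (L%:R / (L + p)%:R) ^+ 2).
  rewrite -(subnKC (ltnW Ln)); apply: le_trans (H _) _.
  have : 0 <= L%:R / (L + (n - L))%:R :> R by [].
  set t := _ / _ => t0; have := sqr_ge0 t; lra.
elim: p => [|p IH].
  by rewrite addn0 divff ?gt_eqF // expr1n !subrr mulr0 !addr0; exact: small.
rewrite addnS big_ord_recr /=.
have Lp : (0 < L + p)%N by rewrite addn_gt0 L0.
apply: le_trans (lerD IH (riemann_weight_step_far h0 Lp)) _.
have : (L + p).+1%:R = (L + p)%:R + 1 :> R by rewrite -natr1.
have : 1 <= (L + p)%:R :> R by rewrite ler1n.
move: (L + p)%:R (L + p).+1%:R => x y x1 ->; rewrite /h.
have -> : 2 / L%:R / (x / L%:R) ^+ 2 = 2 * L%:R / x ^+ 2.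
  by field; rewrite !gt_eqF //; lra.
have -> : (x / L%:R) ^- 2 = (L%:R / x) ^+ 2 by rewrite -exprVn invf_div.
have -> : ((x + 1) / L%:R) ^- 2 = (L%:R / (x + 1)) ^+ 2 by rewrite -exprVn invf_div.
suff : 2 * L%:R / x ^+ 2 <= 4 * (L%:R / x - L%:R / (x + 1)) by lra.
have -> : L%:R / x - L%:R / (x + 1) = L%:R / (x * (x + 1)).
  by field; rewrite !gt_eqF //; lra.
have -> : 4 * (L%:R / (x * (x + 1))) = 2 * L%:R * (2 / (x * (x + 1))).
  by field; rewrite !gt_eqF //; lra.
rewrite ler_pM2l ?mulr_gt0 // -[2 / _]invf_div lef_pV2 ?posrE; first nra.
- by rewrite exprn_gt0 //; lra.
- by rewrite divr_gt0 // mulr_gt0; lra.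
Qed.

Lemma abel_summation c (w : nat -> R) n :
  \sum_(l < n) c l * w l = (\sum_(l < n) c l) * w n +
    \sum_(l < n) (\sum_(i < l.+1) c i) * (w l - w l.+1).
Proof.
elim: n => [|n IH]; first by rewrite !big_ord0 mul0r addr0.
by rewrite big_ord_recr /= IH [\sum_(l < n.+1) _ * (_ - _)]big_ord_recr /= big_ord_recr /=; ring.
Qed.

(** Regularity of Riemann's summation method, by Abel summation against weights of bounded
    variation. The first M partial sums are merely bounded, by S, but there each weight moves by at
    most 2 h; the later partial sums are small. *)
Lemma riemann_summation c : series c @ \oo --> 0 -> forall e : R, 0 < e ->
  exists L0 : nat, forall L : nat, (L0 < L)%N ->
  \forall n \near \oo, `|\sum_(l < n) c l * riemann_weight L%:R^-1 l| <= e.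
Proof.
move=> c0 e e0.
have [S SP] : exists S : R, forall n, `|\sum_(l < n) c l| <= S.
  have cb : cvgn (series c) by apply/cvg_ex; exists 0.
  have [S [_ /(_ (S + 1))]] := cvg_seq_bounded cb.
  by rewrite ltrDl ltr01 => /(_ isT) H; exists (S + 1) => n; rewrite -seriesE; exact: H.
have S0 : 0 <= S by exact: le_trans (SP 0%N).
(* The budget: e/2 for the first M partial sums, 7 e/16 for the later ones by the variation bound,
   e/16 for the boundary term. *)
have e16 : 0 < e / 16 by lra.
have /cvgrPdist_le/(_ _ e16)[M _ HM] := c0.
have {}HM n : (M <= n)%N -> `|\sum_(l < n) c l| <= e / 16.
  by move=> Mn; have := HM n Mn; rewrite /= sub0r normrN seriesE.
(* Chosen so that L > B gives S M (2 h) <= e/2. *)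
pose B := 4 * S * M%:R / e.
have B0 : 0 <= B by rewrite /B mulr_ge0 ?invr_ge0 ?(ltW e0) // !mulr_ge0.
exists (Num.bound B) => L LB.
have L0 : (0 < L)%N by exact: leq_ltn_trans LB.
have LR : 0 < L%:R :> R by rewrite ltr0n.
have BL : B < L%:R by apply: lt_trans (archi_boundP B0) _; rewrite ltr_nat.
set h := L%:R^-1; have h0 : 0 < h by rewrite invr_gt0.
have Sh : S * M%:R * (2 * h) <= e / 2.
  rewrite /h mulrA ler_pdivrMr //; move: BL; rewrite /B ltr_pdivrMr //; lra.
exists M => // n /= Mn.
rewrite abel_summation; apply: le_trans (ler_normD _ _) _.
have H1 : `|(\sum_(l < n) c l) * riemann_weight h n| <= e / 16.
  by rewrite normrM -[leRHS]mulr1 ler_pM // ?HM // riemann_weight_le1.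
suff H2 : `|\sum_(l < n) (\sum_(i < l.+1) c i) * (riemann_weight h l - riemann_weight h l.+1)|
    <= e / 2 + e / 16 * 7 by lra.
apply: le_trans (ler_norm_sum _ _ _) _.
apply: (@le_trans _ _ (\sum_(l < n) ((if (l < M)%N then S * (2 * h) else 0) +
   e / 16 * `|riemann_weight h l - riemann_weight h l.+1|))).
  apply: ler_sum => l _; rewrite normrM; case: ltnP => lM.
    rewrite -[leLHS]addr0; apply: lerD; last by rewrite mulr_ge0 // ltW.
    by apply: ler_pM => //; exact: riemann_weight_step.
  by rewrite add0r ler_wpM2r // HM // (leq_trans lM).
rewrite big_split /= -mulr_sumr; apply: lerD; last first.
  apply: ler_wpM2l; [exact: ltW|exact: riemann_weight_variation].
rewrite -big_mkcond /= -(big_ord_widen n (fun=> S * (2 * h)) Mn).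
rewrite sumr_const card_ord -[_ *+ M]mulr_natr; lra.
Qed.

End Sinc.

(** * Schwarz's lemma on the second symmetric derivative *)

Section Schwarz.
Variable R : realType.
Implicit Types (G : R -> R) (b x e : R).

(** A vanishing second symmetric derivative, tested along the steps 2 h with h = 1 / L; the factor 4
    h^2 is the square of the step. *)
Definition flat_second_difference G := forall x e, 0 < e ->
  exists L0 : nat, forall L : nat, (L0 < L)%N ->
  `|G (x + 2 * L%:R^-1) + G (x - 2 * L%:R^-1) - 2 * G x| <= 4 * L%:R^-1 ^+ 2 * e.

(** Maximum principle: adding e x^2 raises the second difference by 8 e h^2, which beats the allowed
    - 4 e h^2, so the maximum of G + e x^2 over [-b, b] is attained at an end point. *)
Lemma schwarz_le G b e : continuous G -> flat_second_difference G -> 0 < b -> 0 < e ->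
  G (- b) = G b -> G 0 <= G b + e * b ^+ 2.
Proof.
move=> cG sG b0 e0 Gb.
pose f x := G x + e * x ^+ 2.
have cf : {within `[- b, b], continuous f}.
  apply: continuous_subspaceT => x; apply: cvgD; first exact: cG.
  by apply: cvgM; [exact: cvg_cst|exact: exprn_continuous].
have [|c cb Hc] := @EVT_max R f (- b) b _ cf; first by lra.
have f0 : f 0 <= f c by apply: Hc; rewrite in_itv /=; apply/andP; split; lra.
have fb : f (- b) = f b by rewrite /f Gb sqrrN.
suff fcb : f c <= f b.
  by move: (le_trans f0 fcb); rewrite /f expr0n /= mulr0 addr0.
rewrite leNgt; apply/negP => bc.
have [cb1 cb2] : - b < c /\ c < b.
  move: cb; rewrite in_itv /= => /andP[c1 c2]; split; rewrite lt_neqAle ?c1 ?c2 andbT.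
    by apply: contraTneq bc => <-; rewrite fb ltxx.
  by apply: contraTneq bc => ->; rewrite ltxx.
have [L0 HL] := sG c e e0.
pose d := Num.min (b - c) (c + b).
have d0 : 0 < d by rewrite lt_min; apply/andP; split; lra.
pose L := (maxn L0 (Num.bound (2 / d))).+1.
have LL0 : (L0 < L)%N by rewrite ltnS leq_maxl.
have LR : 0 < L%:R :> R by rewrite ltr0n.
have Ld : 2 * L%:R^-1 < d.
  rewrite ltr_pdivrMr // mulrC -ltr_pdivrMr //.
  apply: (@lt_le_trans _ _ (Num.bound (2 / d))%:R); last first.
    by rewrite ler_nat; exact/leqW/leq_maxr.
  by apply: archi_boundP; rewrite divr_ge0 // ltW.
have := HL L LL0.
have : 0 < L%:R^-1 :> R by rewrite invr_gt0.
move: (L%:R^-1) Ld => h hd h0.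
have [hd1 hd2] : 2 * h < b - c /\ 2 * h < c + b by move: hd; rewrite lt_min => /andP[].
have : f (c + 2 * h) <= f c by apply: Hc; rewrite in_itv /=; apply/andP; split; lra.
have : f (c - 2 * h) <= f c by apply: Hc; rewrite in_itv /=; apply/andP; split; lra.
rewrite /f ler_norml => h1 h2 /andP[h3 _].
have : 0 < e * h ^+ 2 by rewrite mulr_gt0 // exprn_gt0.
have -> : e * h ^+ 2 = (e * (c + 2 * h) ^+ 2 + e * (c - 2 * h) ^+ 2 - 2 * (e * c ^+ 2)) / 8.
  by field.
have E : 4 * h ^+ 2 * e = (e * (c + 2 * h) ^+ 2 + e * (c - 2 * h) ^+ 2 - 2 * (e * c ^+ 2)) / 2.
  by field.
rewrite E in h3; lra.
Qed.

(** Evenness supplies the equal end values for the maximum principle and leaves a constant where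
    Schwarz's lemma gives an affine function. The principle is applied to G and to - G, with e / b^2
    so that the perturbation at [b] is e. *)
Lemma schwarz G b : continuous G -> flat_second_difference G ->
  (forall x, G (- x) = G x) -> G b = G 0.
Proof.
move=> cG sG eG.
wlog b0 : b / 0 < b.
  move=> H; case: (ltgtP b 0) => [b0|b0|->//]; last exact: H.
  by rewrite -eG; apply: H; rewrite oppr_gt0.
apply/eqP; rewrite eq_le; apply/andP; split; apply/ler_addgt0Pr => e e0.
  have := @schwarz_le (fun x => - G x) b (e / b ^+ 2).
  rewrite divfK ?gt_eqF ?exprn_gt0 // => H.
  suff : - G 0 <= - G b + e by lra.
  apply: H => //.
  - by move=> x; apply: cvgN; exact: cG.
  - move=> x e1 e10; have [L0 HL] := sG x e1 e10; exists L0 => L /HL.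
    rewrite -normrN; apply: le_trans; rewrite le_eqVlt; apply/orP; left; apply/eqP.
    by congr (`|_|); ring.
  - by rewrite divr_gt0 // exprn_gt0.
  - by rewrite eG.
have := @schwarz_le G b (e / b ^+ 2).
rewrite divfK ?gt_eqF ?exprn_gt0 //; apply => //.
by rewrite divr_gt0 // exprn_gt0.
Qed.

End Schwarz.

(** * Discrete orthogonality and absolutely convergent cosine series *)

Section CosineOrthogonality.
Variable R : realType.
Implicit Types (a x : R) (e : nat -> R).

Lemma cvgn_abs_sum e : cvgn (series (fun l => `|e l|)) ->
  exists S : R, [/\ forall n, \sum_(l < n) `|e l| <= S
    & forall eps : R, 0 < eps -> exists N : nat, forall n, (N <= n)%N ->
        S - \sum_(l < n) `|e l| <= eps].
Proof.
move=> /cvg_ex[S HS]; exists S; split=> [n|eps eps0].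
  exact: (nondecreasing_cvgn_bound n (fun l => normr_ge0 (e l)) HS).
have /cvgrPdist_le/(_ _ eps0)[N _ HN] := HS; exists N => n Nn.
by apply: le_trans (ler_norm _) _; have := HN n Nn; rewrite /= seriesE.
Qed.

Lemma dirichlet_kernel a M :
  2 * sin a * \sum_(r < M) cos (r%:R * (2 * a)) = sin (M%:R * (2 * a) - a) + sin a.
Proof.
elim: M => [|M IH]; first by rewrite big_ord0 mul0r sub0r sinN mulr0 addNr.
rewrite big_ord_recr /= mulrDr IH.
have -> : M.+1%:R * (2 * a) - a = M%:R * (2 * a) + a by rewrite -natr1; ring.
by rewrite sinB sinD; ring.
Qed.

(** The mean of cos (j x) over the [M] points x = 2 pi r / M, a finite substitute for integration
    over a period. *)
Definition root_mean (M j : nat) : R :=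
  M%:R^-1 * \sum_(r < M) cos (r%:R * (2 * (pi * j%:R / M%:R))).

Lemma root_mean_eq0 M j : (0 < j < M)%N -> root_mean M j = 0.
Proof.
move=> /andP[j0 jM]; have M0 : 0 < M%:R :> R by rewrite ltr0n (leq_trans _ jM).
have j0R : 0 < j%:R :> R by rewrite ltr0n.
pose a : R := pi * j%:R / M%:R.
have sa : 0 < sin a.
  apply: sin_gt0_pi; rewrite /a divr_gt0 ?mulr_gt0 ?pi_gt0 //=.
  by rewrite ltr_pdivrMr // ltr_pM2l ?pi_gt0 // ltr_nat.
have := dirichlet_kernel a M.
have -> : M%:R * (2 * a) - a = - a + (pi *+ 2) *+ j.
  rewrite /a -[pi *+ 2 *+ j]mulr_natr -[pi *+ 2]mulr_natr.
  by field; rewrite gt_eqF.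
rewrite (periodicn (@sinD2pi R)) sinN addNr => /eqP.
by rewrite mulf_eq0 mulf_eq0 pnatr_eq0 (gt_eqF sa) /= /root_mean => /eqP ->; rewrite mulr0.
Qed.

Lemma root_mean0 M : (0 < M)%N -> root_mean M 0 = 1.
Proof.
move=> M0; rewrite /root_mean.
under eq_bigr do rewrite mulr0 mul0r mulr0 mulr0 cos0.
by rewrite sumr_const card_ord mulVf // pnatr_eq0 -lt0n.
Qed.

Lemma root_mean_le1 M j : (0 < M)%N -> `|root_mean M j| <= 1.
Proof.
move=> M0; rewrite normrM normfV [`|M%:R|]ger0_norm // ler_pdivrMl ?ltr0n // mulr1.
apply: le_trans (ler_norm_sum _ _ _) _.
apply: (@le_trans _ _ (\sum_(r < M) 1)); last by rewrite sumr_const card_ord.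
by apply: ler_sum => r _; exact: cos_max.
Qed.

(** Average against cos (p x) over [M] equally spaced points. The index [p] keeps weight at least
    1/2, the other indices below [K] drop out, and aliasing touches only the tail, which absolute
    convergence makes small. *)
Lemma abs_cos_series_eq0 e : cvgn (series (fun l => `|e l|)) ->
  (forall x, series (fun l => e l * cos (l%:R * x)) @ \oo --> 0) ->
  forall p, e p = 0.
Proof.
move=> ce e0 p.
(* The mean of cos (l x) cos (p x), by the product formula; [l - p + (p - l)] is |l - p| under
   truncated subtraction. *)
pose A M l : R := (root_mean M (l + p) + root_mean M (l - p + (p - l))%N) / 2.
have AE M : (0 < M)%N -> (fun n => \sum_(l < n) e l * A M l) @ \oo --> 0.
  move=> M0.
  pose x (r : nat) : R := 2 * (pi * r%:R / M%:R).
  have H : (fun n => M%:R^-1 * \sum_(r < M) cos (p%:R * x r) *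
      series (fun l => e l * cos (l%:R * x r)) n) @ \oo -->
      M%:R^-1 * \sum_(r < M) cos (p%:R * x r) * 0.
    apply: cvgM; first exact: cvg_cst.
    by apply: cvg_sumE => r; apply: cvgM; [exact: cvg_cst|exact: e0].
  have E0 : M%:R^-1 * (\sum_(r < M) cos (p%:R * x r) * 0) = 0 :> R.
    by under eq_bigr do rewrite mulr0; rewrite big1 // mulr0.
  rewrite E0 in H; apply: cvg_trans H; apply: near_eq_cvg; near=> n.
  under eq_bigr do rewrite seriesE mulr_sumr.
  rewrite exchange_big /= mulr_sumr; apply: eq_bigr => l _.
  rewrite /A /root_mean -mulrDr -big_split /= -mulrA mulrCA mulr_suml !mulr_sumr.
  apply: eq_bigr => r _; congr (_ * _).
  have -> : r%:R * (2 * (pi * (l + p)%:R / M%:R)) = l%:R * x r + p%:R * x r.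
    by rewrite /x natrD; ring.
  have -> : cos (r%:R * (2 * (pi * (l - p + (p - l))%:R / M%:R))) =
      cos (l%:R * x r - p%:R * x r).
    rewrite /x natrD; case: (leqP l p) => lp.
      rewrite (natrB _ lp) (eqP lp) -[LHS]cosN; congr cos; ring.
    have /eqP -> : (p - l == 0)%N by rewrite subn_eq0 ltnW.
    by rewrite (natrB _ (ltnW lp)); congr cos; ring.
  by rewrite cosD cosB; field.
have A1 M l : (0 < M)%N -> `|A M l| <= 1.
  move=> M0; rewrite /A normrM [`|2^-1|]ger0_norm // ler_pdivrMr // mul1r.
  apply: le_trans (ler_normD _ _) _.
  by have := root_mean_le1 (l + p) M0; have := root_mean_le1 (l - p + (p - l))%N M0; lra.
have [S [HS HN']] := cvgn_abs_sum ce.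
apply/eqP; rewrite -normr_eq0; apply/eqP/le_anti; rewrite normr_ge0 andbT.
apply/ler_addgt0Pr => eps eps0; rewrite add0r.
have eps2 : 0 < eps / 2 by lra.
have [N0 HN] := HN' _ eps2.
(* With [p < K] and [M = K + p], both l + p and |l - p| stay below [M] for [l < K]. *)
pose K := (maxn N0 p).+1; pose M := (K + p)%N.
have M0 : (0 < M)%N by [].
have pK : (p < K)%N by rewrite ltnS leq_maxr.
have tail n : (K <= n)%N -> \sum_(K <= l < n) `|e l| <= eps / 2.
  move=> Kn; have HK : S - \sum_(l < K) `|e l| <= eps / 2.
    by apply: HN; exact/leqW/leq_maxl.
  have := HS n; rewrite -(big_mkord xpredT (fun l => `|e l|)) (big_cat_nat (n := K)) //=.
  rewrite big_mkord; lra.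
have Ap : 2^-1 <= `|A M p|.
  rewrite /A subnn addn0 root_mean0 //.
  case: (posnP p) => [->|p0]; first by rewrite addn0 root_mean0 // ger0_norm; lra.
  by rewrite root_mean_eq0 ?add0r ?mul1r ?ger0_norm // /M; apply/andP; split; lia.
have A0 l : (l < K)%N -> l != p -> A M l = 0.
  move=> lK lp; rewrite /A !root_mean_eq0 ?addr0 ?mul0r // /M; apply/andP; split; lia.
have HZ : `|e p * A M p| <= eps / 2.
  have Hc : (fun n => e p * A M p - \sum_(l < n) e l * A M l) @ \oo --> e p * A M p.
    by rewrite -[X in _ --> X]subr0; apply: cvgB; [exact: cvg_cst|exact: AE].
  apply: (lim_norm_le Hc); exists K => // n /= Kn.
  rewrite -(big_mkord xpredT (fun l => e l * A M l)) (big_cat_nat (n := K)) //=.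
  rewrite [X in _ - (X + _)]big_mkord (bigD1 (Ordinal pK)) //= big1; last first.
    by move=> l lp; rewrite A0 ?mulr0.
  rewrite addr0 opprD addNKr normrN; apply: le_trans (ler_norm_sum _ _ _) _.
  apply: le_trans (tail n Kn); apply: ler_sum => l _.
  by rewrite normrM -[leRHS]mulr1 ler_wpM2l // A1.
move: HZ; rewrite normrM => HZ.
have : `|e p| * 2^-1 <= `|e p| * `|A M p| by rewrite ler_wpM2l.
lra.
Unshelve. all: by end_near. Qed.

End CosineOrthogonality.

(** * Cantor's theorem and its Chebyshev form *)

Section CantorUniqueness.
Variable R : realType.
Implicit Types (x y b : R) (d r : nat -> R).

Lemma cos_series_cvg r x : cvgn (series (fun l => `|r l|)) ->
  cvgn (series (fun l => r l * cos (l%:R * x))).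
Proof.
move=> /cvgn_abs_sum[S [HS _]]; apply: (@cvgn_series_bounded _ _ S) => n.
apply: le_trans (HS n).
apply: ler_sum => l _; rewrite normrM -[leRHS]mulr1 ler_wpM2l //; exact: cos_max.
Qed.

Definition cos_series r x : R := limn (series (fun l => r l * cos (l%:R * x))).

Lemma cos_series_continuous r : cvgn (series (fun l => `|r l|)) ->
  continuous (cos_series r).
Proof.
move=> cr x; have [S [HS HN]] := cvgn_abs_sum cr.
apply/cvgrPdist_le => e e0.
have e4 : 0 < e / 4 by lra.
have {HN} [N /(_ N (leqnn N)) SN] := HN _ e4.
pose T := \sum_(l < N) `|r l| * l%:R.
have T0 : 0 <= T by apply: sumr_ge0 => l _; rewrite mulr_ge0.
have T1 : 0 < T + 1 by lra.
near=> y.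
have xy : `|x - y| <= e / 2 / (T + 1).
  near: y; apply/nbhs_ballP; exists (e / 2 / (T + 1)) => /=; first by rewrite divr_gt0 //; lra.
  by move=> z; rewrite /ball /= => /ltW.
have Hc : (fun n => series (fun l => r l * cos (l%:R * x)) n -
    series (fun l => r l * cos (l%:R * y)) n) @ \oo -->
    cos_series r x - cos_series r y.
  by apply: cvgB; exact: cos_series_cvg.
apply: (lim_norm_le Hc); exists N => // n /= Nn.
rewrite !seriesE -sumrB.
apply: le_trans (ler_norm_sum _ _ _) _.
rewrite -(big_mkord xpredT (fun l => `|r l * cos (l%:R * x) - r l * cos (l%:R * y)|)).
rewrite (big_cat_nat (n := N)) //= big_mkord.
have H1 : \sum_(l < N) `|r l * cos (l%:R * x) - r l * cos (l%:R * y)| <= e / 2.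
  apply: (@le_trans _ _ (T * `|x - y|)).
    rewrite mulr_suml; apply: ler_sum => l _.
    rewrite -mulrBr normrM -mulrA ler_wpM2l //; apply: le_trans (cos_lip _ _) _.
    by rewrite -mulrBr normrM ger0_norm.
  apply: (@le_trans _ _ ((T + 1) * `|x - y|)); first by rewrite ler_wpM2r // lerDl.
  by move: xy; rewrite ler_pdivlMr // mulrC.
have H2 : \sum_(N <= l < n) `|r l * cos (l%:R * x) - r l * cos (l%:R * y)| <= e / 2.
  apply: (@le_trans _ _ (\sum_(N <= l < n) 2 * `|r l|)).
    apply: ler_sum => l _; rewrite -mulrBr normrM mulrC ler_wpM2r //.
    apply: le_trans (ler_normB _ _) _.
    by have := cos_max (l%:R * x); have := cos_max (l%:R * y); lra.
  rewrite -mulr_sumr.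
  have := HS n.
  by rewrite -(big_mkord xpredT (fun l => `|r l|)) (big_cat_nat (n := N)) //= big_mkord; lra.
lra.
Unshelve. all: by end_near. Qed.

(** The term l = 0 is 0, the inverse of 0 being 0; the others telescope by 1/x^2 <= 2/x -
    2/(x+1). *)
Lemma sum_inv_sqr_le n : \sum_(l < n.+1) (l%:R ^- 2 : R) <= 4 - 2 / n.+1%:R.
Proof.
elim: n => [|n IH]; first by rewrite big_ord_recr big_ord0 /= expr0n invr0; lra.
rewrite big_ord_recr /=; apply: le_trans (lerD IH (lexx _)) _.
have : n.+2%:R = n.+1%:R + 1 :> R by rewrite -natr1.
have : 1 <= n.+1%:R :> R by rewrite ler1n.
move: (n.+1%:R) (n.+2%:R) => x y x0 ->.
suff : x ^- 2 <= 2 / x - 2 / (x + 1) by lra.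
have -> : 2 / x - 2 / (x + 1) = (x * (x + 1) / 2)^-1.
  by field; rewrite !gt_eqF //; lra.
rewrite lef_pV2 ?posrE; first nra.
- by rewrite exprn_gt0 //; lra.
- by rewrite divr_gt0 // mulr_gt0; lra.
Qed.

(** Termwise double integration: the second difference with step 2 h is 4 h^2 times the sum of d_l
    cos (l x) with Riemann's weights, which the summation method makes small. *)
Lemma cantor_flat d : (forall x, series (fun l => d l * cos (l%:R * x)) @ \oo --> 0) ->
  let r l := d l / l%:R ^+ 2 in
  cvgn (series (fun l => `|r l|)) /\
  flat_second_difference (fun x => d 0%N * x ^+ 2 / 2 - cos_series r x).
Proof.
move=> d0 r.
(* At x = 0 the hypothesis says that the coefficients themselves form a convergent series; this
   bounds them and makes [r] absolutely summable. *)
have d_cvg : cvgn (series d).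
  apply/cvg_ex; exists 0; have := d0 0; rewrite /series /=.
  by under eq_fun do under eq_bigr do rewrite mulr0 cos0 mulr1.
have [B [_ /(_ (B + 1))]] := cvg_series_bounded d_cvg.
rewrite ltrDl ltr01 => /(_ isT) HB.
have {}HB l : `|d l| <= B + 1 by exact: HB.
have r_cvg : cvgn (series (fun l => `|r l|)).
  apply: (@cvgn_series_bounded _ _ ((B + 1) * 4)) => -[|n].
    by rewrite big_ord0 mulr_ge0 // (le_trans _ (HB 0%N)).
  apply: (@le_trans _ _ ((B + 1) * \sum_(l < n.+1) l%:R ^- 2)).
    rewrite mulr_sumr; apply: ler_sum => l _.
    rewrite /r normr_id normrM ler_pM // normfV ger0_norm //.
  apply: ler_wpM2l; first by rewrite (le_trans _ (HB 0%N)).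
  by apply: le_trans (sum_inv_sqr_le n) _; rewrite gerDl oppr_le0 divr_ge0.
split=> // x e e0.
have [L0 HL] := riemann_summation (d0 x) e0.
exists L0 => L LL0; have Lgt0 : (0 < L)%N by exact: leq_ltn_trans LL0.
have := HL L LL0.
set h := L%:R^-1 => -[N _ HN].
have h0 : 0 < h by rewrite invr_gt0 ltr0n.
pose s y n := series (fun l => r l * cos (l%:R * y)) n.
have sc y : s y @ \oo --> cos_series r y by exact: cos_series_cvg.
have Hc : (fun n => (d 0%N * (x + 2 * h) ^+ 2 / 2 - s (x + 2 * h) n) +
    (d 0%N * (x - 2 * h) ^+ 2 / 2 - s (x - 2 * h) n) -
    2 * (d 0%N * x ^+ 2 / 2 - s x n)) @ \oo -->
    (d 0%N * (x + 2 * h) ^+ 2 / 2 - cos_series r (x + 2 * h)) +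
    (d 0%N * (x - 2 * h) ^+ 2 / 2 - cos_series r (x - 2 * h)) -
    2 * (d 0%N * x ^+ 2 / 2 - cos_series r x).
  apply: cvgB; last first.
    by apply: cvgM; [exact: cvg_cst|apply: cvgB; [exact: cvg_cst|exact: sc]].
  by apply: cvgD; apply: cvgB; [exact: cvg_cst|exact: sc|exact: cvg_cst|exact: sc].
(* With at least one term present the index 0 can be split off: [r] is 0 there by division by zero,
   and d_0 x^2 / 2 accounts for the weight 1. *)
apply: (lim_norm_le Hc); exists N.+1 => // -[//|n] /= Nn.
have /HN /= H : (N <= n.+1)%N by exact: ltnW.
suff -> : d 0%N * (x + 2 * h) ^+ 2 / 2 - s (x + 2 * h) n.+1 +
    (d 0%N * (x - 2 * h) ^+ 2 / 2 - s (x - 2 * h) n.+1) -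
    2 * (d 0%N * x ^+ 2 / 2 - s x n.+1) =
    4 * h ^+ 2 * \sum_(l < n.+1) d l * cos (l%:R * x) * riemann_weight h l.
  have h4 : 0 <= 4 * h ^+ 2 by rewrite mulr_ge0 // sqr_ge0.
  by rewrite normrM (ger0_norm h4); exact: ler_wpM2l.
have -> : d 0%N * (x + 2 * h) ^+ 2 / 2 - s (x + 2 * h) n.+1 +
    (d 0%N * (x - 2 * h) ^+ 2 / 2 - s (x - 2 * h) n.+1) -
    2 * (d 0%N * x ^+ 2 / 2 - s x n.+1) = 4 * h ^+ 2 * d 0%N +
    (2 * s x n.+1 - s (x + 2 * h) n.+1 - s (x - 2 * h) n.+1) by field.
rewrite /s !seriesE mulr_sumr -!sumrB mulr_sumr !big_ord_recl /=.
rewrite /r !expr0n /= invr0 !mulr0 !mul0r !subr0 mulr0 add0r cos0 mulr1 /riemann_weight /=.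
rewrite mulr1; congr (_ + _); apply: eq_bigr => l _; rewrite /bump /= add1n.
have l0 : 0 < l.+1%:R :> R by rewrite ltr0n.
move: (d _) (l.+1%:R) l0 => dl t t0.
have -> : t * (x + 2 * h) = t * x + (t * h + t * h) by ring.
have -> : t * (x - 2 * h) = t * x - (t * h + t * h) by ring.
rewrite cosD cosB (cosD (t * h)) -!expr2 cos2sin2.
by field; rewrite !gt_eqF.
Qed.

(* Cantor's theorem, by Riemann's method: the series integrated twice has zero
   second symmetric derivative, so it is affine by Schwarz's lemma. *)
Theorem cantor_uniqueness d :
  (forall x, series (fun l => d l * cos (l%:R * x)) @ \oo --> 0) -> forall p, d p = 0.
Proof.
move=> d0; pose r l := d l / l%:R ^+ 2.
have [cr flatG] := cantor_flat d0; rewrite -/r in cr flatG.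
set G := fun x : R => _ in flatG.
have cG : continuous G.
  move=> x; apply: cvgB; last exact: cos_series_continuous.
  apply: cvgM; last exact: cvg_cst.
  by apply: cvgM; [exact: cvg_cst|exact: exprn_continuous].
have eG x : G (- x) = G x.
  rewrite /G sqrrN /cos_series; congr (_ - limn (series _)).
  by apply/funext => l; rewrite mulrN cosN.
have GE x : G x = G 0 by exact: schwarz.
(* The cosine series has period 2 pi, so the quadratic term must vanish for [G] to be constant. *)
have d00 : d 0%N = 0.
  have := GE (pi *+ 2); rewrite /G expr0n /= mulr0 mul0r.
  have -> : cos_series r (pi *+ 2) = cos_series r 0.
    rewrite /cos_series; congr (limn (series _)); apply/funext => l.
    by rewrite mulr0 mulr_natl -[pi *+ 2 *+ l]add0r (periodicn (@cosD2pi R)).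
  move/addIr/eqP.
  rewrite mulf_eq0 invr_eq0 pnatr_eq0 orbF mulf_eq0 expf_eq0 /= mulrn_eq0 /=.
  by rewrite (gt_eqF (pi_gt0 R)) orbF => /eqP.
have sE x : cos_series r x = cos_series r 0.
  by have := GE x; rewrite /G d00 !mul0r !sub0r => /oppr_inj.
(* The constant value of the series, moved into the coefficient of index 0, leaves an absolutely
   convergent series with sum 0. *)
pose e l := if l == 0%N then - cos_series r 0 else r l.
have r0 : r 0%N = 0 by rewrite /r d00 mul0r.
have eS (f : nat -> R) n : \sum_(l < n.+1) e l * f l =
    \sum_(l < n.+1) r l * f l - cos_series r 0 * f 0%N.
  by rewrite !big_ord_recl /= r0 mul0r add0r /e /= mulNr addrC.
have ez : forall p, e p = 0.
  apply: abs_cos_series_eq0.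
    have [S [HS _]] := cvgn_abs_sum cr.
    apply: (@cvgn_series_bounded _ _ (`|cos_series r 0| + S)) => n.
    apply: (@le_trans _ _ (\sum_(l < n) `|e l|)); first by under eq_bigr do rewrite normr_id.
    case: n => [|n]; first by rewrite big_ord0 addr_ge0 // (le_trans _ (HS 0%N)) // big_ord0.
    have := HS n.+1; rewrite !big_ord_recl /= d00 mul0r normr0 add0r /e /= normrN lerD2l; apply.
  move=> x; apply/cvgrPdist_le => eps eps0.
  have /cvgrPdist_le/(_ _ eps0)[N _ HN] := @cos_series_cvg r x cr.
  exists N.+1 => // -[//|n] /= Nn; have /HN /= : (N <= n.+1)%N by exact: ltnW.
  rewrite -/(cos_series r x) sE sub0r normrN !seriesE (eS (fun l => cos (l%:R * x))) mul0r cos0 mulr1.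
  by rewrite distrC.
case=> [//|p]; have := ez p.+1; rewrite /e /= /r => /eqP.
by rewrite mulf_eq0 invr_eq0 expf_eq0 pnatr_eq0 /= orbF => /eqP.
Qed.

(** The three-term recurrence makes cos (l x) depend on cos x alone. This evaluates [chebT] at cos
    x, where [acos (cos x)] may differ from [x]. *)
Lemma cos_mul_eq x y (l : nat) : cos x = cos y -> cos (l%:R * x) = cos (l%:R * y).
Proof.
move=> xy; suff : cos (l%:R * x) = cos (l%:R * y) /\ cos (l.+1%:R * x) = cos (l.+1%:R * y) by case.
elim: l => [|l [IH1 IH2]]; first by rewrite !mul0r !mul1r.
split=> //.
have step z : cos (l.+2%:R * z) = 2 * cos z * cos (l.+1%:R * z) - cos (l%:R * z).
  have -> : l.+2%:R * z = l.+1%:R * z + z by rewrite -(natr1 l.+1); ring.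
  have -> : l%:R * z = l.+1%:R * z - z by rewrite -(natr1 l); ring.
  by rewrite cosD cosB; ring.
by rewrite !step IH1 IH2 xy.
Qed.

Lemma chebT_cos (l : nat) x : chebT l (cos x) = cos (l%:R * x).
Proof.
by apply: cos_mul_eq; rewrite acosK // in_itv /= cos_geN1 cos_le1.
Qed.

Lemma chebT_series_eq0 d : (forall x, -1 <= x <= 1 ->
  series (fun l => d l * chebT l x) @ \oo --> 0) -> forall p, d p = 0.
Proof.
move=> H; apply: cantor_uniqueness => x.
have := H (cos x); rewrite cos_geN1 cos_le1 => /(_ isT).
by under eq_fun do rewrite chebT_cos.
Qed.

End CantorUniqueness.

(** * Laplace integrals on a ray *)

Section HalfLine.
Variable R : realType.
Implicit Types (a c t th : R) (f F w : R -> R).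
Notation mu := (@lebesgue_measure R).
Notation D := (`]0%R, +oo[%classic : set R).

(** Raise b t <= exp (b t), with b = c / a, to the power [a]. *)
Lemma powR_le_expR a c : 0 < a -> 0 < c -> exists2 C : R, 0 <= C &
  forall t, 0 <= t -> t `^ a <= C * expR (c * t).
Proof.
move=> a0 c0; pose b := c / a; have b0 : 0 < b by rewrite divr_gt0.
exists (b^-1 `^ a) => [|t t0]; first exact: powR_ge0.
have -> : c * t = b * t * a by rewrite /b; field; rewrite gt_eqF.
rewrite expRM -powRM ?expR_ge0 ?invr_ge0 ?(ltW b0) //.
apply: ge0_ler_powR; rewrite ?nnegrE ?(ltW a0) //.
  by rewrite mulr_ge0 ?expR_ge0 ?invr_ge0 ?(ltW b0).
rewrite ler_pdivlMl //; apply: le_trans (expR_ge1Dx _); lra.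
Qed.

Lemma measurable_halfline : measurable D.
Proof. exact: measurable_itv. Qed.

Lemma integrable_expR_halfline c : 0 < c ->
  mu.-integrable D (fun t => (expR (- c * t))%:E).
Proof.
move=> c0.
have H : mu.-integrable D (fun t => (c^-1%:E * (exponential_pdf c t)%:E)%E).
  apply: integrableZl => //.
  by apply: (integrableS measurableT) => //; exact: integrable_exponential_pdf.
apply: eq_integrable H => // t; rewrite inE /= in_itv /= andbT => t0.
by rewrite exponential_pdfE ?ltW // -EFinM mulrA mulVf ?mul1r // gt_eqF.
Qed.

Lemma integrable_scale c f : mu.-integrable D (EFin \o f) ->
  mu.-integrable D (EFin \o (fun t => c * f t)).
Proof.
move=> fi; rewrite (_ : EFin \o _ = (fun t => (c%:E * (EFin \o f) t)%E)).
  by apply: integrableZl.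
by apply/funext => t /=; rewrite EFinM.
Qed.

Lemma integrable_sub f w : mu.-integrable D (EFin \o f) -> mu.-integrable D (EFin \o w) ->
  mu.-integrable D (EFin \o (fun t => f t - w t)).
Proof.
move=> fi wi; rewrite (_ : EFin \o _ = (fun t => ((EFin \o f) t - (EFin \o w) t)%E)).
  by apply: integrableB.
by apply/funext => t /=; rewrite EFinB.
Qed.

Lemma integrable_damped a c w : 0 < a -> 0 < c -> measurable_fun D w ->
  (forall t, 0 < t -> `|w t| <= expR (- c * t)) ->
  mu.-integrable D (fun t => (t `^ a * w t)%:E).
Proof.
move=> a0 c0 mw wle.
have c20 : 0 < c / 2 by lra.
have [C C0 HC] := powR_le_expR a0 c20.
have mf : measurable_fun D (fun t => (t `^ a * w t)%:E).
  apply/measurable_EFinP/measurable_funM => //.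
  by apply: measurable_funTS; exact: measurable_powR.
apply: le_integrable (integrable_scale C (integrable_expR_halfline c20)) => //.
move=> t /=; rewrite in_itv /= andbT => t0.
rewrite lee_fin [leRHS]ger0_norm ?mulr_ge0 ?expR_ge0 // normrM ger0_norm ?powR_ge0 //.
apply: (@le_trans _ _ (C * expR (c / 2 * t) * expR (- c * t))).
  by apply: ler_pM => //; [exact: powR_ge0|exact/HC/ltW|exact: wle].
rewrite -mulrA -expRD le_eqVlt; apply/orP; left; apply/eqP; congr (_ * expR _).
by field.
Qed.

(** The form in which integration by parts is used: the fundamental theorem on compact intervals
    exhausting the half-line, then dominated convergence. *)
Lemma Rintegral_derive_eq0 F f :
  (forall t, 0 < t -> is_derive t 1 F (f t)) ->
  (forall t, 0 < t -> {for t, continuous f}) ->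
  mu.-integrable D (EFin \o f) ->
  (fun n : nat => F n.+2%:R) @ \oo --> 0 ->
  (fun n : nat => F n.+2%:R^-1) @ \oo --> 0 ->
  \int[mu]_(t in D) f t = 0.
Proof.
move=> dF cf intf Fy F0.
(* The shift by 2 makes the left end point strictly smaller than the right one. *)
pose I (n : nat) : set R := `[n.+2%:R^-1, n.+2%:R]%classic.
have ID n t : I n t -> 0 < t.
  by rewrite /I /= in_itv /= => /andP[h _]; apply: lt_le_trans h; rewrite invr_gt0.
have FTC n : \int[mu]_(t in D) (f \_ (I n)) t = F n.+2%:R - F n.+2%:R^-1.
  rewrite -Rintegral_mkcondr.
  have -> : D `&` I n = I n.
    by apply/seteqP; split=> t /=; [case|move=> It; split=> //; rewrite in_itv /= (ID _ _ It)].
  rewrite /Rintegral (@continuous_FTC2 R f F) //.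
  - have n2 : 1 < n.+2%:R :> R by rewrite ltr1n.
    by rewrite (lt_trans _ n2) // invf_lt1 // (lt_trans _ n2).
  - by apply: continuous_in_subspaceT => t; rewrite inE => /ID; exact: cf.
  - split.
    + move=> t tI; have t0 : 0 < t by apply/(ID n)/subset_itv_oo_cc.
      by have := dF t t0; case.
    + apply: cvg_at_right_filter; apply: (is_derive_continuous (dF _ _)).
      by rewrite invr_gt0.
    + by apply: cvg_at_left_filter; apply: (is_derive_continuous (dF _ _)).
  - move=> t tI; have t0 : 0 < t by apply/(ID n)/subset_itv_oo_cc.
    by rewrite derive1E; have := dF t t0 => d; exact: derive_val.
have mf : measurable_fun D f by apply/measurable_EFinP; exact: measurable_int intf.
have L : (fun n => \int[mu]_(t in D) (f \_ (I n)) t) @ \oo --> \int[mu]_(t in D) f t.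
  apply: fine_cvg; rewrite fineK; last exact: integrable_fin_num.
  apply: (@dominated_cvg _ _ _ mu D measurable_halfline
    (fun n t => ((f \_ (I n)) t)%:E) (EFin \o f) (fun t => `|(f t)%:E|%E)).
  - move=> n; apply/measurable_EFinP/measurable_restrict => //.
      exact: measurable_itv.
    by apply: (measurable_funS _ _ mf) => // t /= [].
  - move=> t; rewrite /= in_itv /= andbT => t0.
    apply: cvg_EFin; first exact: nearW.
    apply: cvg_near_cst; exists (Num.bound (t + t^-1)) => // n /= nt.
    have b0 : 0 <= t + t^-1 by apply: addr_ge0; rewrite ?invr_ge0 ltW.
    have tn : t + t^-1 < n.+2%:R.
      by apply: lt_le_trans (archi_boundP b0) _; rewrite ler_nat; lia.
    have tv : 0 < t^-1 by rewrite invr_gt0.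
    rewrite /= patchE ifT // inE /I /= in_itv /=; apply/andP; split; last by lra.
    by rewrite invf_ple ?posrE //; lra.
  - by move=> t _.
  - exact: integrable_abse.
  - move=> n t _; rewrite lee_fin patchE; case: ifP => // _.
    by rewrite normr0.
have L0 : (fun n => \int[mu]_(t in D) (f \_ (I n)) t) @ \oo --> 0.
  under eq_fun do rewrite FTC.
  by have := cvgB Fy F0; rewrite subrr => H; exact: H.
exact: (cvg_unique (@Rhausdorff R) L L0).
Qed.

(** Together with [rot_sin], the real part and minus the imaginary part of t^a exp(- t e^(i th)). *)
Definition rot_cos a th t := t `^ a * (expR (- (t * cos th)) * cos (t * sin th)).
Definition rot_sin a th t := t `^ a * (expR (- (t * cos th)) * sin (t * sin th)).

Lemma integrable_rot a th (u : R -> R) : 0 < a -> 0 < cos th ->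
  continuous u -> (forall t, `|u t| <= 1) ->
  mu.-integrable D (fun t => (t `^ a * (expR (- (t * cos th)) * u t))%:E).
Proof.
move=> a0 c0 cu u1; apply: (integrable_damped a0 c0).
  apply: measurable_funTS; apply: continuous_measurable_fun => t.
  apply: cvgM; last exact: cu.
  by apply: (is_derive_continuous (f := fun t => expR (- (t * cos th)))); derive1_rules.
move=> t t0; rewrite normrM ger0_norm ?expR_ge0 // -[leRHS]mulr1.
by rewrite mulNr [cos th * t]mulrC ler_wpM2l ?expR_ge0.
Qed.

Lemma continuous_cosM c : continuous (fun t => cos (t * c)).
Proof. by move=> t; apply: is_derive_continuous; derive1_rules. Qed.

Lemma continuous_sinM c : continuous (fun t => sin (t * c)).
Proof. by move=> t; apply: is_derive_continuous; derive1_rules. Qed.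

Lemma integrable_rot_cos a th : 0 < a -> 0 < cos th ->
  mu.-integrable D (EFin \o rot_cos a th).
Proof.
by move=> a0 c0; apply: integrable_rot => // [|t]; [exact: continuous_cosM|exact: cos_max].
Qed.

Lemma integrable_rot_sin a th : 0 < a -> 0 < cos th ->
  mu.-integrable D (EFin \o rot_sin a th).
Proof.
by move=> a0 c0; apply: integrable_rot => // [|t]; [exact: continuous_sinM|exact: sin_max].
Qed.

Definition int_cos a th := \int[mu]_(t in D) rot_cos a th t.
Definition int_sin a th := \int[mu]_(t in D) rot_sin a th t.

(** Both boundary terms are O(1/n). At infinity half of the decay absorbs the power and the other
    half is at most 2 / (c t); at 0 the assumption [1 <= a] gives t^a <= t. *)
Lemma damped_cvg0 a c w : 1 <= a -> 0 < c ->
  (forall t, 0 < t -> `|w t| <= expR (- c * t)) ->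
  (fun n : nat => n.+2%:R `^ a * w n.+2%:R) @ \oo --> 0 /\
  (fun n : nat => n.+2%:R^-1 `^ a * w n.+2%:R^-1) @ \oo --> 0.
Proof.
move=> a1 c0 wle.
have sq (u : nat -> R) (C : R) : (forall n, `|u n| <= C * n.+2%:R^-1) -> u @ \oo --> 0.
  move=> uC; apply: norm_cvg0.
  apply: (@squeeze_cvgr _ _ _ _ (cst 0) (fun n : nat => C * n.+2%:R^-1)).
  - by apply: nearW => n; rewrite /= normr_ge0 uC.
  - exact: cvg_cst.
  rewrite -[X in _ --> X](mulr0 C); apply: cvgM; first exact: cvg_cst.
  have := @cvg_harmonic R; rewrite -(cvg_shiftn 1).
  by under eq_fun do rewrite /harmonic addn1.
have a0 : 0 < a by lra.
have c20 : 0 < c / 2 by lra.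
have [C C0 HC] := powR_le_expR a0 c20.
split.
  apply: (sq _ (C * (2 / c))) => n; set t : R := n.+2%:R.
  have t0 : 0 < t by rewrite ltr0n.
  rewrite normrM ger0_norm ?powR_ge0 //.
  apply: (@le_trans _ _ (C * expR (c / 2 * t) * expR (- c * t))).
    by apply: ler_pM => //; [exact: powR_ge0|exact/HC/ltW|exact: wle].
  rewrite -!mulrA ler_wpM2l // -expRD.
  have -> : c * (2^-1 * t) + - c * t = - (c / 2 * t) by field.
  rewrite expRN -[c^-1 / t]invfM -[2]invrK -invfM lef_pV2 ?posrE ?expR_gt0 ?mulr_gt0 //.
  by apply: le_trans (expR_ge1Dx _); lra.
apply: (sq _ 1) => n; set t : R := n.+2%:R^-1.
have t0 : 0 < t by rewrite invr_gt0.
rewrite normrM ger0_norm ?powR_ge0 // mul1r -[leRHS]mulr1; apply: ler_pM => //.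
- exact: powR_ge0.
- by apply: ge1r_powR => //; rewrite t0 /= invf_le1 // ler1n.
- apply: le_trans (wle _ t0) _; rewrite -expR0 ler_expR mulNr oppr_le0.
  by rewrite mulr_ge0 // ltW.
Qed.

Lemma is_derive_powR_shift a t : 0 < t ->
  is_derive t 1 (fun x => x `^ (a + 1)) ((a + 1) * t `^ a).
Proof. by move=> t0; have := is_derive1_powR (a + 1) t0; rewrite addrK. Qed.

Lemma powR_succ a t : 0 < t -> t `^ (a + 1) = t `^ a * t.
Proof. by move=> t0; rewrite powRD ?powRr1 ?ltW // (gt_eqF t0) implybT. Qed.

Lemma continuous_rot a th (u : R -> R) t : 0 < t -> continuous u ->
  {for t, continuous (fun t => t `^ a * (expR (- (t * cos th)) * u t))}.
Proof.
move=> t0 cu; apply: cvgM; first exact: is_derive_continuous (is_derive1_powR a t0).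
apply: cvgM; last exact: cu.
by apply: (is_derive_continuous (f := fun t => expR (- (t * cos th)))); derive1_rules.
Qed.

Lemma rot_le th (u : R -> R) t : (forall t, `|u t| <= 1) ->
  `|expR (- (t * cos th)) * u t| <= expR (- cos th * t).
Proof.
move=> u1; rewrite normrM ger0_norm ?expR_ge0 // mulNr [cos th * t]mulrC.
by rewrite -[leRHS]mulr1 ler_wpM2l ?expR_ge0.
Qed.

(* Componentwise form of e^(i th) J_(a+1) = (a+1) J_a, where
   J_a = \int_0^oo t^a exp(- t e^(i th)) dt = int_cos a th - i int_sin a th. *)
Lemma int_rot_rec a th : 0 < a -> 0 < cos th ->
  cos th * int_cos (a + 1) th + sin th * int_sin (a + 1) th = (a + 1) * int_cos a th /\
  cos th * int_sin (a + 1) th - sin th * int_cos (a + 1) th = (a + 1) * int_sin a th.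
Proof.
move=> a0 c0; have a10 : 0 < a + 1 by lra.
have Ic := integrable_rot_cos a0 c0; have Is := integrable_rot_sin a0 c0.
have Ic1 := integrable_rot_cos a10 c0; have Is1 := integrable_rot_sin a10 c0.
have mD := measurable_halfline.
have a11 : 1 <= a + 1 by lra.
have cw k : forall t, 0 < t -> {for t, continuous (rot_cos k th)}.
  by move=> t t0; apply: continuous_rot => //; exact: continuous_cosM.
have sw k : forall t, 0 < t -> {for t, continuous (rot_sin k th)}.
  by move=> t t0; apply: continuous_rot => //; exact: continuous_sinM.
split.
  have := @Rintegral_derive_eq0 (rot_cos (a + 1) th) (fun t => (a + 1) * rot_cos a th t -
    cos th * rot_cos (a + 1) th t - sin th * rot_sin (a + 1) th t).
  rewrite RintegralB ?RintegralB ?RintegralZl //; [|by apply: integrable_scale|by apply: integrable_scale|by apply: integrable_sub; apply: integrable_scale|by apply: integrable_scale].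
  rewrite -!/(int_cos _ _) -!/(int_sin _ _) => H.
  suff : (a + 1) * int_cos a th - cos th * int_cos (a + 1) th - sin th * int_sin (a + 1) th = 0 by lra.
  have [L1 L2] := damped_cvg0 a11 c0 (fun t _ => rot_le th t (fun t => cos_max (t * sin th))).
  apply: H => //.
  - move=> t t0; eapply is_derive_eq.
      by apply: is_deriveME; first exact: is_derive_powR_shift.
    by rewrite /rot_cos /rot_sin /GRing.scale /=; ring.
  - move=> t t0; apply: cvgB; [apply: cvgB|]; apply: cvgM; try exact: cvg_cst;
      [exact: cw|exact: cw|exact: sw].
  - by apply: integrable_sub; [apply: integrable_sub|]; apply: integrable_scale.
have := @Rintegral_derive_eq0 (rot_sin (a + 1) th) (fun t => (a + 1) * rot_sin a th t -
  cos th * rot_sin (a + 1) th t - (- sin th) * rot_cos (a + 1) th t).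
rewrite RintegralB ?RintegralB ?RintegralZl //; [|by apply: integrable_scale|by apply: integrable_scale|by apply: integrable_sub; apply: integrable_scale|by apply: integrable_scale].
rewrite -!/(int_cos _ _) -!/(int_sin _ _) => H.
suff : (a + 1) * int_sin a th - cos th * int_sin (a + 1) th - (- sin th) * int_cos (a + 1) th = 0 by lra.
have [L1 L2] := damped_cvg0 a11 c0 (fun t _ => rot_le th t (fun t => sin_max (t * sin th))).
apply: H => //.
- move=> t t0; eapply is_derive_eq.
    by apply: is_deriveME; first exact: is_derive_powR_shift.
  by rewrite /rot_cos /rot_sin /GRing.scale /=; ring.
- move=> t t0; apply: cvgB; [apply: cvgB|]; apply: cvgM; try exact: cvg_cst;
    [exact: sw|exact: sw|exact: cw].
- by apply: integrable_sub; [apply: integrable_sub|]; apply: integrable_scale.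
Qed.

Lemma integrable_powR_expR a c : 0 < a -> 0 < c ->
  mu.-integrable D (fun t => (2 * (t `^ a * expR (- c * t)))%:E).
Proof.
move=> a0 c0; have mD := measurable_halfline.
apply: integrable_scale; apply: (@integrable_damped a c) => // [|t t0].
  apply: measurable_funTS; apply: continuous_measurable_fun => t.
  by apply: is_derive_continuous; derive1_rules.
by rewrite ger0_norm ?expR_ge0.
Qed.

(* Differentiation under the integral sign on ]- v, v[ with v < pi / 2, where
   cos is at least cos v. *)
Lemma is_derive_int_rot a (w w' : R -> R -> R) th : 0 < a -> 0 <= th < pi / 2 ->
  (forall x, 0 < cos x -> mu.-integrable D (fun t => (t `^ a * w x t)%:E)) ->
  (forall x t : R, is_derive x 1 (w ^~ t) (t * w' x t)) ->
  (forall x t, `|w' x t| <= 2 * expR (- (t * cos x))) ->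
  is_derive th 1 (fun x => \int[mu]_(t in D) (t `^ a * w x t))
    (\int[mu]_(t in D) (t `^ (a + 1) * w' th t)).
Proof.
move=> a0 /andP[th0 thpi] intw dw w'le.
pose v := (th + pi / 2) / 2.
have thv : th < v by rewrite /v; lra.
have vpi : v < pi / 2 by rewrite /v; lra.
have pi0 := pi_gt0 R.
have cosv x : `]- v, v[%classic x -> cos v <= cos x.
  rewrite /= in_itv /= => /andP[x1 x2].
  rewrite -(cos_norm x); have xv : `|x| < v by rewrite ltr_norml x1.
  by rewrite ltW // ltr_cos // in_itv /=; apply/andP; split => //; lra.
have cv0 : 0 < cos v by apply: cos_gt0_pihalf; apply/andP; split; lra.
have Ia : `]- v, v[%classic th by rewrite /= in_itv /=; apply/andP; split; lra.
have dE (x t : R) : is_derive x 1 ((fun x t => t `^ a * w x t) ^~ t) (t `^ a * (t * w' x t)).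
  by have d := is_deriveME (is_derive_cstE (t `^ a) x) (dw x t); rewrite mul0r add0r in d.
have pE x t : partial1of2 (fun x t => t `^ a * w x t) x t = t `^ a * (t * w' x t).
  by rewrite partial1of2E; have d := dE x t; exact: derive_val.
have a10 : 0 < a + 1 by lra.
have H1 x : `]- v, v[%classic x -> mu.-integrable D (EFin \o (fun t => t `^ a * w x t)).
  by move=> /cosv xv; apply: intw; exact: lt_le_trans xv.
have H2 x t : `]- v, v[%classic x -> D t -> derivable ((fun x t => t `^ a * w x t) ^~ t) x 1.
  by move=> _ _; have := dE x t; case.
pose G (t : R) : R := 2 * (t `^ (a + 1) * expR (- cos v * t)).
have G0 t : 0 <= G t by rewrite mulr_ge0 // mulr_ge0 ?powR_ge0 ?expR_ge0.
have GI : mu.-integrable D (EFin \o G) by exact: integrable_powR_expR.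
have H3 x t : `]- v, v[%classic x -> D t ->
    `|partial1of2 (fun x t => t `^ a * w x t) x t| <= G t.
  move=> /cosv xv; rewrite /= in_itv /= andbT => t0.
  have tt0 : 0 <= t `^ a * t by rewrite mulr_ge0 ?powR_ge0 // ltW.
  rewrite pE /G powR_succ // mulrA normrM (ger0_norm tt0) mulrCA.
  apply: ler_wpM2l => //; apply: le_trans (w'le x t) _.
  by rewrite ler_wpM2l // ler_expR mulNr lerN2 mulrC ler_wpM2l // ltW.
apply: DeriveDef.
  exact: (@derivable_under_integral _ _ _ mu (fun x t => t `^ a * w x t) D
    (measurable_itv _) th (- v) v Ia H1 H2 G G0 GI H3).
rewrite -derive1E.
rewrite (@differentiation_under_integral _ _ _ mu (fun x t => t `^ a * w x t) D
    (measurable_itv _) th (- v) v Ia H1 H2 G G0 GI H3).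
apply: eq_Rintegral => t; rewrite inE /= in_itv /= andbT => t0.
by rewrite pE powR_succ // mulrA.
Qed.

Lemma norm_mix_le (E p q r s : R) : 0 <= E ->
  `|p| <= 1 -> `|q| <= 1 -> `|r| <= 1 -> `|s| <= 1 ->
  `|p * (E * q)| + `|r * (E * s)| <= 2 * E.
Proof.
move=> E0 p1 q1 r1 s1.
have H u v : `|u| <= 1 -> `|v| <= 1 -> `|u * (E * v)| <= E.
  move=> u1 v1; rewrite !normrM (ger0_norm E0) mulrCA -[leRHS]mulr1 ler_wpM2l //.
  by rewrite -[leRHS]mul1r ler_pM.
by have := H p q p1 q1; have := H r s r1 s1; lra.
Qed.

(** Under the integral sign, J_a' = - i e^(i th) J_(a+1), and the recurrence turns this into - i (a
    + 1) J_a; its components are this lemma and the next. *)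
Lemma is_derive_int_cos a th : 0 < a -> 0 <= th < pi / 2 ->
  is_derive th 1 (int_cos a) (- ((a + 1) * int_sin a th)).
Proof.
move=> a0 hth; have pi0 := pi_gt0 R; have a10 : 0 < a + 1 by lra.
have c0 : 0 < cos th by apply: cos_gt0_pihalf; move: hth => /andP[? ?]; apply/andP; split; lra.
have Ic1 := integrable_rot_cos a10 c0; have Is1 := integrable_rot_sin a10 c0.
have mD := measurable_halfline.
eapply is_derive_eq.
  apply: (@is_derive_int_rot a (fun x t => expR (- (t * cos x)) * cos (t * sin x))
    (fun x t => sin x * (expR (- (t * cos x)) * cos (t * sin x)) -
                cos x * (expR (- (t * cos x)) * sin (t * sin x)))) => //.
  - by move=> x cx; exact: integrable_rot_cos.
  - by move=> x t; eapply is_derive_eq; [derive1_rules|rewrite /GRing.scale /=; ring].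
  - move=> x t; apply: le_trans (ler_normB _ _) _.
    by apply: norm_mix_le; rewrite ?expR_ge0 ?sin_max ?cos_max.
have [_ <-] := int_rot_rec a0 c0.
rewrite opprB /int_cos /int_sin -!RintegralZl // -RintegralB //.
- by apply: eq_Rintegral => t _; rewrite /rot_cos /rot_sin; ring.
- exact: (integrable_scale (sin th) Ic1).
- exact: (integrable_scale (cos th) Is1).
Qed.

Lemma is_derive_int_sin a th : 0 < a -> 0 <= th < pi / 2 ->
  is_derive th 1 (int_sin a) ((a + 1) * int_cos a th).
Proof.
move=> a0 hth; have pi0 := pi_gt0 R; have a10 : 0 < a + 1 by lra.
have c0 : 0 < cos th by apply: cos_gt0_pihalf; move: hth => /andP[? ?]; apply/andP; split; lra.
have Ic1 := integrable_rot_cos a10 c0; have Is1 := integrable_rot_sin a10 c0.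
have mD := measurable_halfline.
eapply is_derive_eq.
  apply: (@is_derive_int_rot a (fun x t => expR (- (t * cos x)) * sin (t * sin x))
    (fun x t => sin x * (expR (- (t * cos x)) * sin (t * sin x)) +
                cos x * (expR (- (t * cos x)) * cos (t * sin x)))) => //.
  - by move=> x cx; exact: integrable_rot_sin.
  - by move=> x t; eapply is_derive_eq; [derive1_rules|rewrite /GRing.scale /=; ring].
  - move=> x t; apply: le_trans (ler_normD _ _) _.
    by apply: norm_mix_le; rewrite ?expR_ge0 ?sin_max ?cos_max.
have [<- _] := int_rot_rec a0 c0.
rewrite [RHS]addrC /int_cos /int_sin -!RintegralZl // -RintegralD //.
- by apply: eq_Rintegral => t _; rewrite /rot_cos /rot_sin; ring.
- exact: (integrable_scale (sin th) Is1).
- exact: (integrable_scale (cos th) Ic1).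
Qed.

Lemma int_rot0 a : int_cos a 0 = Gamma (a + 1) /\ int_sin a 0 = 0.
Proof.
split.
  by apply: eq_Rintegral => t _; rewrite /rot_cos sin0 cos0 mulr0 mulr1 cos0 mulr1 addrK.
rewrite /int_sin (@eq_Rintegral _ _ _ _ _ (cst 0)) => [|t _]; first by rewrite Rintegral_cst // mul0r.
by rewrite /rot_sin sin0 mulr0 sin0 !mulr0.
Qed.

Lemma int_rot_norm a th : 0 < a -> 0 <= th < pi / 2 ->
  int_cos a th ^+ 2 + int_sin a th ^+ 2 = Gamma (a + 1) ^+ 2.
Proof.
move=> a0 /andP[th0 thpi].
have H := @is_derive_lip R (fun x => int_cos a x * int_cos a x + int_sin a x * int_sin a x)
  (fun=> 0) 0 0 th th0.
have [E1 E2] := int_rot0 a.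
move: H; rewrite mul0r E1 E2 mulr0 addr0 -!expr2 => H.
apply/eqP; rewrite -subr_eq0 -normr_eq0; apply/eqP/le_anti; rewrite normr_ge0 andbT.
apply: H => x; rewrite in_itv /= => /andP[x0 xth]; last by rewrite normr0.
have hx : 0 <= x < pi / 2 by rewrite x0 (le_lt_trans xth).
have dc := is_derive_int_cos a0 hx; have ds := is_derive_int_sin a0 hx.
eapply is_derive_eq; first by apply: is_deriveDE; apply: is_deriveME; eassumption.
by rewrite /GRing.scale /=; ring.
Qed.

Lemma Gamma_succ a : 0 < a -> Gamma (a + 2) = (a + 1) * Gamma (a + 1) :> R.
Proof.
move=> a0; have c0 : 0 < cos 0 :> R by rewrite cos0.
have [H _] := int_rot_rec a0 c0; move: H.
by rewrite cos0 sin0 mul1r mul0r addr0 !(int_rot0 _).1 -addrA.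
Qed.

Lemma Gamma_gt0 a : 0 < a -> 0 < Gamma (a + 1) :> R.
Proof.
move=> a0; rewrite -(int_rot0 a).1; have c0 : 0 < cos 0 :> R by rewrite cos0.
have irot := integrable_rot_cos a0 c0.
have sub : `[1%R, 2%R]%classic `<=` D.
  by move=> t /=; rewrite !in_itv /= => /andP[t1 _]; rewrite andbT; lra.
have m12 : measurable (`[1%R, 2%R]%classic : set R) by exact: measurable_itv.
have rE t : rot_cos a 0 t = t `^ a * expR (- t).
  by rewrite /rot_cos sin0 cos0 mulr0 mulr1 cos0 mulr1.
have r0 t : 0 <= rot_cos a 0 t by rewrite rE mulr_ge0 ?powR_ge0 ?expR_ge0.
(* On [1, 2] the integrand is at least exp(-2), as t^a >= 1 there. *)
apply: (@lt_le_trans _ _ (\int[mu]_(t in `[1%R, 2%R]%classic) (expR (- 2) : R))).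
  rewrite Rintegral_cst // mulr_gt0 ?expR_gt0 //.
  have E : @lebesgue_measure R [set` `[1%R, 2%R]] = 1%:E.
    by rewrite lebesgue_measure_itv /= lte_fin ltr1n /= -EFinD; congr EFin; lra.
  by rewrite -[X in fine X]/(@lebesgue_measure R [set` `[1%R, 2%R]]) E /=.
apply: (@le_trans _ _ (\int[mu]_(t in `[1%R, 2%R]%classic) rot_cos a 0 t)).
  apply: le_Rintegral => //.
  - apply: (@le_integrable _ _ _ mu _ m12 _ (EFin \o rot_cos a 0)).
    + exact: measurable_cst.
    + move=> t; rewrite /= in_itv /= => /andP[t1 t2].
      rewrite lee_fin !ger0_norm ?expR_ge0 // rE -[leLHS]mul1r ler_pM ?expR_ge0 //.
        by have := ler_powR t1 (ltW a0); rewrite powRr0.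
      by rewrite ler_expR lerN2.
    + by apply: integrableS irot => //.
  - by apply: integrableS irot => //.
  - move=> t; rewrite /= in_itv /= => /andP[t1 t2].
    rewrite rE -[leLHS]mul1r ler_pM ?expR_ge0 //.
      by have := ler_powR t1 (ltW a0); rewrite powRr0.
    by rewrite ler_expR lerN2.
have -> : `[1%R, 2%R]%classic = D `&` `[1%R, 2%R]%classic.
  by apply/seteqP; split=> t /=; [move=> h; split=> //; exact: sub|case].
rewrite Rintegral_mkcondr; apply: le_Rintegral => //.
  rewrite -restrict_EFin; apply/integrable_restrict => //.
  by apply: integrableS irot => //; exact: measurableI.
by move=> t _; rewrite patchE; case: ifP.
Qed.

End HalfLine.

(** * The Laplace integral of [U] in complex form *)

Section ComplexIntegral.
Variable R : realType.
Implicit Types (a t th x y : R).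
Notation mu := (@lebesgue_measure R).
Notation D := (`]0%R, +oo[%classic : set R).

Definition cis th : R[i] := cos th +i* sin th.

Lemma cexp_cis th : cexp (0 +i* th) = cis th.
Proof. by rewrite /cexp /= expR0 mul1r. Qed.

Lemma cis_conj th : cis th * (cis th)^* = 1.
Proof.
by rewrite -sqr_normc -add_Re2_Im2 /= cos2Dsin2.
Qed.

Lemma cisX th l : cis th ^+ l = cis (l%:R * th).
Proof.
elim: l => [|l IH]; first by rewrite expr0 mul0r /cis cos0 sin0.
rewrite exprS IH -natr1 mulrDl mul1r addrC /cis; apply/eqP.
by rewrite eq_complex /= cosD sinD; apply/andP; split; apply/eqP; ring.
Qed.

Lemma cexp_rot t x y : cexp (- t%:C * (x +i* y)) =
  (expR (- (t * x)) * cos (t * y)) +i* (- (expR (- (t * x)) * sin (t * y))).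
Proof.
rewrite /cexp /=; apply/eqP; rewrite eq_complex /=.
have -> : - t * x - - 0 * y = - (t * x) by ring.
have -> : - t * y + - 0 * x = - (t * y) by ring.
by rewrite cosN sinN; apply/andP; split; apply/eqP; ring.
Qed.

Lemma integral_sum_scale N (c : nat -> R) (f : nat -> R -> R) :
  (forall i, mu.-integrable D (EFin \o f i)) ->
  mu.-integrable D (EFin \o (fun t => \sum_(i < N) c i * f i t)) /\
  \int[mu]_(t in D) (\sum_(i < N) c i * f i t) =
  \sum_(i < N) c i * \int[mu]_(t in D) f i t.
Proof.
move=> fi; elim: N => [|N [IH1 IH2]].
  have E : (fun t => \sum_(i < 0) c i * f i t) = (fun t => 0 * f 0%N t).
    by apply/funext => t; rewrite big_ord0 mul0r.
  split; first by rewrite E; exact: integrable_scale.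
  by rewrite E RintegralZl // mul0r big_ord0.
have E : (fun t => \sum_(i < N.+1) c i * f i t) =
    (fun t => \sum_(i < N) c i * f i t - (- c N) * f N t).
  by apply/funext => t; rewrite big_ord_recr /= mulNr opprK.
split; first by rewrite E; apply: integrable_sub => //; exact: integrable_scale.
rewrite E RintegralB //; last exact: integrable_scale.
by rewrite IH2 RintegralZl // big_ord_recr /= mulNr opprK.
Qed.

Definition rot_int a th : R[i] := int_cos a th +i* (- int_sin a th).

Lemma rot_int_rec a th : 0 < a -> 0 < cos th ->
  cis th * rot_int (a + 1) th = (a + 1)%:C * rot_int a th.
Proof.
move=> a0 c0; have [H1 H2] := int_rot_rec a0 c0.
apply/eqP; rewrite eq_complex /=; apply/andP; split; apply/eqP.
  by rewrite mul0r subr0 -H1; ring.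
by rewrite mul0r addr0 [in RHS]mulrN -H2; ring.
Qed.

Lemma rot_int_rising a th p : 0 < a -> 0 < cos th ->
  cis th ^+ p * rot_int (a + p%:R) th = (rising (a + 1) p)%:C * rot_int a th.
Proof.
move=> a0 c0; elim: p => [|p IH].
  by rewrite addr0 expr0 /rising big_ord0.
rewrite -natr1 addrA exprSr -mulrA rot_int_rec //; last first.
  by apply: lt_le_trans a0 _; rewrite lerDl.
rewrite mulrCA IH /rising big_ord_recr /= rmorphM /= [in RHS]mulrAC [RHS]mulrC.
by have -> : a + 1 + p%:R = a + p%:R + 1 by ring.
Qed.

Lemma Gamma_rising a p : 0 < a ->
  Gamma (a + p%:R + 1) = rising (a + 1) p * Gamma (a + 1) :> R.
Proof.
move=> a0; elim: p => [|p IH]; first by rewrite addr0 /rising big_ord0 mul1r.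
rewrite /rising big_ord_recr /= -/(rising _ _) mulrAC -IH -natr1.
have ap : 0 < a + p%:R by apply: lt_le_trans a0 _; rewrite lerDl.
have := Gamma_succ ap.
have -> : a + p%:R + 2 = a + (p%:R + 1) + 1 by ring.
by move=> ->; rewrite mulrC; congr (_ * _); ring.
Qed.

Lemma rot_int_norm a th : 0 < a -> 0 <= th < pi / 2 ->
  `|rot_int a th| ^+ 2 = (Gamma (a + 1) ^+ 2)%:C.
Proof. by move=> a0 h; rewrite -add_Re2_Im2 /= sqrrN int_rot_norm. Qed.

Variables (k : nat) (g : R) (lam : 'I_k -> R) (m : 'I_k -> nat) (n : nat).
Hypothesis g_ok : forall p : nat, g != - p%:R.
Hypothesis ng1 : 1 < n%:R + g.

Lemma U_nodal t : 0 < t ->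
  U g lam n m t = \sum_(p < (mtot m).+1) (nodal lam m)`_p * t `^ (n%:R + g - 1 + p%:R).
Proof.
move=> t0; rewrite /U.
have -> : \prod_(p < k) (t - lam p) ^+ m p = (nodal lam m).[t].
  by rewrite /nodal horner_prod; apply: eq_bigr => j _; rewrite horner_exp hornerXsubC.
rewrite horner_coef size_nodal mulr_sumr; apply: eq_bigr => p _.
rewrite [in RHS]powRD; last by rewrite (gt_eqF t0) implybT.
by rewrite powR_mulrn ?ltW // mulrCA.
Qed.

Definition laplace_integrand th t : R[i] :=
  (U g lam n m t)%:C * cexp (- t%:C * (cos th +i* sin th)).

Lemma laplace_integral th : 0 < cos th ->
  cintegrable D (laplace_integrand th) /\
  cintegral D (laplace_integrand th) =
    \sum_(p < (mtot m).+1) ((nodal lam m)`_p)%:C * rot_int (n%:R + g - 1 + p%:R) th.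
Proof.
move=> c0; pose a (p : nat) := n%:R + g - 1 + p%:R.
have a0 p : 0 < a p by rewrite /a ltr_wpDr // subr_gt0.
have [C1 C2] := @integral_sum_scale (mtot m).+1 (fun p => (nodal lam m)`_p)
  (fun p => rot_cos (a p) th) (fun p => integrable_rot_cos (a0 p) c0).
have [S1 S2] := @integral_sum_scale (mtot m).+1 (fun p => - (nodal lam m)`_p)
  (fun p => rot_sin (a p) th) (fun p => integrable_rot_sin (a0 p) c0).
have ReE : {in D, (fun t => complex.Re (laplace_integrand th t)) =1
    (fun t => \sum_(p < (mtot m).+1) (nodal lam m)`_p * rot_cos (a p) th t)}.
  move=> t /[!inE] tD; have t0 : 0 < t by move: tD; rewrite /= in_itv /= andbT.
  rewrite /laplace_integrand cexp_rot U_nodal //= mul0r subr0 mulr_suml.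
  by apply: eq_bigr => p _; rewrite -mulrA.
have ImE : {in D, (fun t => complex.Im (laplace_integrand th t)) =1
    (fun t => \sum_(p < (mtot m).+1) - (nodal lam m)`_p * rot_sin (a p) th t)}.
  move=> t /[!inE] tD; have t0 : 0 < t by move: tD; rewrite /= in_itv /= andbT.
  rewrite /laplace_integrand cexp_rot U_nodal //= mul0r addr0 mulr_suml.
  by apply: eq_bigr => p _; rewrite /rot_sin; ring.
split.
  split.
    by apply: eq_integrable C1 => [//|t tD]; exact: (congr1 EFin (esym (ReE t tD))).
  by apply: eq_integrable S1 => [//|t tD]; exact: (congr1 EFin (esym (ImE t tD))).
transitivity ((\sum_(p < (mtot m).+1) (nodal lam m)`_p * int_cos (a p) th) +i*
    (\sum_(p < (mtot m).+1) - (nodal lam m)`_p * int_sin (a p) th)).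
  rewrite /cintegral; congr (_ +i* _).
    by rewrite -C2; apply: eq_Rintegral => t tD; exact: ReE.
  by rewrite -S2; apply: eq_Rintegral => t tD; exact: ImE.
apply/eqP; rewrite eq_complex (raddf_sum (@complex.Re R : Rcomplex R -> R)) /=.
rewrite (raddf_sum (@complex.Im R : Rcomplex R -> R)) /=.
apply/andP; split; apply/eqP; apply: eq_bigr => p _ /=.
  by rewrite mul0r subr0.
by rewrite mul0r addr0 mulrN mulNr.
Qed.

(** With a = n + g - 1 the integral is the sum of w_p J_(a+p). Multiplied by e^(i M th), of modulus
    1, each e^(i p th) J_(a+p) becomes (a+1)_p J_a. So J_a factors out, the sum over e^(i (M-p) th)
    is (n+g)_M Q(e^(i th)), and (n+g)_M |J_a| = Gamma(n + M + g). *)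
Lemma laplace_denominator th : 0 <= th < pi / 2 ->
  `|cintegral D (laplace_integrand th)| ^+ 2 =
  (Gamma ((n + mtot m)%:R + g) ^+ 2)%:C *
  `|(map_poly (real_complex R) (nodal_denominator g lam m n)).[cis th]| ^+ 2.
Proof.
move=> hth; have pi0 := pi_gt0 R.
have c0 : 0 < cos th by apply: cos_gt0_pihalf; move: hth => /andP[? ?]; apply/andP; split; lra.
have a0 : 0 < n%:R + g - 1 by rewrite subr_gt0.
have [_ ->] := laplace_integral c0.
have nz : `|cis th ^+ mtot m| = 1.
  by rewrite normrX -(expr1n _ (mtot m)); congr (_ ^+ _); apply/eqP;
    rewrite -(@eqrXn2 _ 2) // expr1n sqr_normc cis_conj.
rewrite -[X in X ^+ 2 = _]mul1r -[in LHS]nz -normrM.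
set S := \sum_(p < _) _.
have -> : cis th ^+ mtot m * S =
    (rising (n%:R + g - 1 + 1) (mtot m))%:C * rot_int (n%:R + g - 1) th *
    (map_poly (real_complex R) (nodal_denominator g lam m n)).[cis th].
  have sz : (size (map_poly (real_complex R) (nodal_denominator g lam m n)) <= (mtot m).+1)%N.
    by rewrite size_map_poly; exact: size_nodal_denominator.
  rewrite (horner_coef_wide _ sz) (reindex_inj rev_ord_inj) /= /S !mulr_sumr.
  apply: eq_bigr => p _; rewrite subSS coef_map /= coef_poly ltnS leq_subr subKn ?leq_ord //.
  have -> : cis th ^+ mtot m = cis th ^+ (mtot m - p) * cis th ^+ p.
    by rewrite -exprD subnK // leq_ord.
  rewrite [LHS](_ : _ = ((nodal lam m)`_p)%:C * cis th ^+ (mtot m - p) *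
    (cis th ^+ p * rot_int (n%:R + g - 1 + p%:R) th)); last by ring.
  rewrite rot_int_rising //.
  have -> : (n + mtot m - (mtot m - p) = n + p)%N by have := leq_ord p; lia.
  have gE : n%:R + g - 1 + 1 = g + n%:R by ring.
  rewrite gE [rising g (n + p)]risingD [rising g (n + mtot m)]risingD.
  have r0 l : rising g l != 0 by exact: rising_neq0.
  have := r0 (n + mtot m)%N; rewrite risingD mulf_eq0 negb_or => /andP[r1 r2].
  have -> : (nodal lam m)`_p * (rising g n * rising (g + n%:R) p) /
     (rising g n * rising (g + n%:R) (mtot m)) =
     (nodal lam m)`_p * rising (g + n%:R) p / rising (g + n%:R) (mtot m).
    by field; rewrite r1 r2.
  rewrite !rmorphM /= fmorphV /=.
  have r2' : (rising (g + n%:R) (mtot m))%:C != 0 by rewrite fmorph_eq0.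
  move: ((rising _ (mtot m))%:C) r2' => X X0; by field.
have -> : (n + mtot m)%:R + g = n%:R + g - 1 + (mtot m)%:R + 1 by rewrite natrD; ring.
rewrite Gamma_rising // !normrM !exprMn rot_int_norm // -mulrA mulrA rmorphM /=.
congr (_ * _).
by rewrite sqr_normc conjc_real -!rmorphM /=; congr (_%:C); ring.
Qed.

End ComplexIntegral.

(** * Power series on the unit circle *)

Section Convolution.
Variable A : comNzRingType.
Implicit Types (q a e : nat -> A) (z : A).

Definition cauchy_prod q a (l : nat) : A := \sum_(p < l.+1) q p * a (l - p)%N.

(** As [q] has finitely many terms, the partial sums of the product are a finite combination of
    shifted partial sums of [a], and limits pass through it without rearranging a double series. *)
Lemma sum_conv q a K n : (forall p, (K <= p)%N -> q p = 0) ->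
  \sum_(l < n) cauchy_prod q a l = \sum_(p < K) q p * \sum_(i < n - p) a i.
Proof.
move=> qK; elim: n => [|n IH].
  by rewrite big_ord0 big1 // => p _; rewrite sub0n big_ord0 mulr0.
rewrite big_ord_recr /= IH /cauchy_prod.
have -> : \sum_(p < n.+1) q p * a (n - p)%N =
    \sum_(p < K) (if (p < n.+1)%N then q p * a (n - p)%N else 0).
  rewrite (big_ord_widen (maxn K n.+1) (fun p => q p * a (n - p)%N)) ?leq_maxr //.
  rewrite (big_ord_widen (maxn K n.+1)
    (fun p => if (p < n.+1)%N then q p * a (n - p)%N else 0)) ?leq_maxl //.
  rewrite big_mkcond [RHS]big_mkcond /=; apply: eq_bigr => p _.
  by case: ltnP => // _; case: ltnP => // Kp; rewrite qK // mul0r.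
rewrite -big_split /=; apply: eq_bigr => p _; case: ltnP => pn.
  by rewrite subSn // big_ord_recr /= mulrDr.
by rewrite addr0; have -> : (n.+1 - p = n - p)%N by move: pn; lia.
Qed.

Lemma conv_geometric q a z l :
  cauchy_prod (fun p => q p * z ^+ p) (fun i => a i * z ^+ i) l = cauchy_prod q a l * z ^+ l.
Proof.
rewrite /cauchy_prod mulr_suml; apply: eq_bigr => p _.
have lp : (p <= l)%N by rewrite -ltnS.
have -> : z ^+ l = z ^+ p * z ^+ (l - p) by rewrite -exprD subnKC.
by ring.
Qed.

(** Prefixes of the power series e / q for q_0 = 1, kept as a list because each new coefficient uses
    all the earlier ones. *)
Fixpoint quotient_seq q e (n : nat) : seq A :=
  if n is n'.+1 then
    let s := quotient_seq q e n' in
    rcons s (e n' - \sum_(i < n') q (n' - i)%N * s`_i)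
  else [::].

Lemma size_quotient_seq q e n : size (quotient_seq q e n) = n.
Proof. by elim: n => //= n IH; rewrite size_rcons IH. Qed.

Lemma exists_quotient q e : q 0%N = 1 -> exists a, forall l, cauchy_prod q a l = e l.
Proof.
move=> q0; pose a i := (quotient_seq q e i.+1)`_i.
have stable n i : (i < n)%N -> (quotient_seq q e n)`_i = a i.
  elim: n => // n IH; rewrite ltnS leq_eqVlt => /orP[/eqP -> //|lin].
  by rewrite /= nth_rcons size_quotient_seq lin IH.
exists a => l; rewrite /cauchy_prod big_ord_recl q0 mul1r subn0.
rewrite {1}/a /= nth_rcons size_quotient_seq ltnn eqxx.
rewrite [X in _ + X](reindex_inj rev_ord_inj) /=.
have -> : \sum_(i < l) q (l - i)%N * (quotient_seq q e l)`_i =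
    \sum_(j < l) q (bump 0 (l - j.+1)) * a (l - bump 0 (l - j.+1))%N.
  apply: eq_bigr => i _; rewrite stable // /bump leq0n add1n.
  by rewrite subnSK // subKn // ltnW.
by rewrite subrK.
Qed.

End Convolution.

(** * Absolute convergence of products, quotients and Taylor series *)

Section AbsoluteConvergence.
Variable R : realType.
Implicit Types (q a e : nat -> R).

Lemma sum_norm_conv_le q a K n : (forall p, (K <= p)%N -> q p = 0) ->
  \sum_(l < n) `|cauchy_prod q a l| <= (\sum_(p < K) `|q p|) * \sum_(l < n) `|a l|.
Proof.
move=> qK; apply: (@le_trans _ _ (\sum_(l < n) cauchy_prod (fun p => `|q p|) (fun i => `|a i|) l)).
  apply: ler_sum => l _; apply: le_trans (ler_norm_sum _ _ _) _.
  by apply: ler_sum => p _; rewrite normrM.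
rewrite (sum_conv _ _ (K := K)); last by move=> p Kp; rewrite qK // normr0.
rewrite mulr_suml; apply: ler_sum => p _; apply: ler_wpM2l => //.
rewrite (big_ord_widen n (fun i => `|a i|)) ?leq_subr // big_mkcond /=.
by apply: ler_sum => i _; case: ifP.
Qed.

Lemma cvgn_series_abs a C : (forall n, \sum_(l < n) `|a l| <= C) ->
  cvgn (series (fun l => `|a l|)).
Proof.
move=> aC; apply: (@cvgn_series_bounded _ _ C) => n.
by under eq_bigr do rewrite normr_id.
Qed.

(** Absorption on partial sums: with q' the part of [q] of positive index, a = q a - q' a, and the
    partial sums of |q' a| are at most half of those of |a|. Hence those of |a| are at most twice
    those of |q a|. *)
Lemma quotient_abs_cvg q a K : q 0%N = 1 -> (forall p, (K < p)%N -> q p = 0) ->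
  \sum_(p < K) `|q p.+1| <= 2^-1 ->
  cvgn (series (fun l => `|cauchy_prod q a l|)) -> cvgn (series (fun l => `|a l|)).
Proof.
move=> q0 qK qle /cvgn_abs_sum[S [HS _]].
apply: (@cvgn_series_abs _ (2 * S)) => n.
pose q' p := if p is p'.+1 then q p else 0.
have aE l : a l = cauchy_prod q a l - cauchy_prod q' a l.
  rewrite /cauchy_prod !big_ord_recl /= q0 mul1r mul0r add0r subn0.
  by rewrite addrK.
have H1 : \sum_(l < n) `|a l| <= \sum_(l < n) `|cauchy_prod q a l| + \sum_(l < n) `|cauchy_prod q' a l|.
  rewrite -big_split /=; apply: ler_sum => l _; rewrite {1}aE; exact: ler_normB.
have H2 : \sum_(l < n) `|cauchy_prod q' a l| <= 2^-1 * \sum_(l < n) `|a l|.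
  have q'K p : (K.+1 <= p)%N -> q' p = 0 by case: p => // p; exact: qK.
  apply: le_trans (sum_norm_conv_le a n q'K) _.
  apply: ler_wpM2r; first exact: sumr_ge0.
  by rewrite big_ord_recl /= normr0 add0r.
have := HS n; lra.
Qed.

Variables (g lam : R).
Hypothesis g_ok : forall p : nat, g != - p%:R.

Lemma coefE_abs_cvg : cvgn (series (fun l => `|Defs.coefE g lam l|)).
Proof.
pose f l := `|Defs.coefE g lam l|.
have f0 l : 0 <= f l by exact: normr_ge0.
have step l : f l.+1 * `|g + l%:R| = f l * `|lam|.
  rewrite /f -!normrM; congr (`|_|); rewrite /Defs.coefE /poch big_ord_recr /= exprSr.
  have r0 : \prod_(i < l) (g + i%:R) != 0 by exact: (rising_neq0 g_ok l).
  have gl : g + l%:R != 0 by rewrite addr_eq0 g_ok.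
  by field; rewrite r0 gl.
pose L := Num.bound (2 * `|lam| + `|g|).
have half l : (L <= l)%N -> 2 * f l.+1 <= f l.
  move=> Ll.
  have gl : 2 * `|lam| <= `|g + l%:R|.
    have b0 : 0 <= 2 * `|lam| + `|g| by rewrite addr_ge0 // mulr_ge0.
    have : 2 * `|lam| + `|g| < l%:R.
      by apply: lt_le_trans (archi_boundP b0) _; rewrite ler_nat.
    have := ler_norm (- g); rewrite normrN => ng; have := ler_norm (g + l%:R); lra.
  have := step l; have := f0 l; have := f0 l.+1.
  have gl0 : 0 < `|g + l%:R| by rewrite normr_gt0 addr_eq0 g_ok.
  move=> h1 h2 h3; rewrite -(ler_pM2r gl0) -mulrA h3 mulrCA ler_wpM2l //.
(* Beyond [L] the terms at least halve; subtracting twice the next term makes this geometric bound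
   inductive. *)
suff H p : \sum_(l < L + p) f l <= \sum_(l < L) f l + 2 * f L - 2 * f (L + p)%N.
  apply: (@cvgn_series_abs _ (\sum_(l < L) f l + 2 * f L)) => n.
  apply: (@le_trans _ _ (\sum_(l < L + n) f l)).
    rewrite (big_ord_widen (L + n) f) ?leq_addl // big_mkcond /=.
    by apply: ler_sum => l _; case: ifP.
  by apply: le_trans (H n) _; have := f0 (L + n)%N; lra.
elim: p => [|p IH]; first by rewrite addn0; lra.
by rewrite addnS big_ord_recr /=; have := half (L + p)%N (leq_addr _ _); lra.
Qed.

End AbsoluteConvergence.

Section ComplexLimits.
Variable R : realType.
Implicit Types (u v : nat -> R[i]) (a q : nat -> R) (th : R).

Definition ccvg u (l : R[i]) : Prop :=
  (fun n => complex.Re (u n)) @ \oo --> complex.Re l /\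
  (fun n => complex.Im (u n)) @ \oo --> complex.Im l.

Lemma ccvg_cst (l : R[i]) : ccvg (fun=> l) l.
Proof. by split; exact: cvg_cst. Qed.

Lemma ccvgD u v (l l' : R[i]) : ccvg u l -> ccvg v l' -> ccvg (fun n => u n + v n) (l + l').
Proof.
move=> [u1 u2] [v1 v2]; split; rewrite raddfD /=.
  by under eq_fun do rewrite raddfD /=; exact: cvgD.
by under eq_fun do rewrite raddfD /=; exact: cvgD.
Qed.

Lemma ccvgMl c u (l : R[i]) : ccvg u l -> ccvg (fun n => c * u n) (c * l).
Proof.
case: c => c1 c2 [u1 u2]; split.
  have -> : complex.Re ((c1 +i* c2) * l) = c1 * complex.Re l - c2 * complex.Im l by case: l {u1 u2}.
  have -> : (fun n => complex.Re ((c1 +i* c2) * u n)) =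
      (fun n => c1 * complex.Re (u n) - c2 * complex.Im (u n)).
    by apply/funext => n; case: (u n).
  by apply: cvgB; apply: cvgM => //; exact: cvg_cst.
have -> : complex.Im ((c1 +i* c2) * l) = c1 * complex.Im l + c2 * complex.Re l by case: l {u1 u2}.
have -> : (fun n => complex.Im ((c1 +i* c2) * u n)) =
    (fun n => c1 * complex.Im (u n) + c2 * complex.Re (u n)).
  by apply/funext => n; case: (u n).
by apply: cvgD; apply: cvgM => //; exact: cvg_cst.
Qed.

Lemma ccvg_sum K (u : nat -> nat -> R[i]) (l : nat -> R[i]) :
  (forall p, ccvg (u p) (l p)) ->
  ccvg (fun n => \sum_(p < K) u p n) (\sum_(p < K) l p).
Proof.
move=> ul; elim: K => [|K IH].
  have -> : (fun n => \sum_(p < 0) u p n) = fun=> 0 by apply/funext => n; rewrite big_ord0.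
  by rewrite big_ord0; exact: ccvg_cst.
have -> : (fun n => \sum_(p < K.+1) u p n) = (fun n => \sum_(p < K) u p n + u K n).
  by apply/funext => n; rewrite big_ord_recr.
by rewrite big_ord_recr; exact: ccvgD.
Qed.

Lemma cvg_subn (f : nat -> R) (l : R) p : f @ \oo --> l -> (fun n => f (n - p)%N) @ \oo --> l.
Proof.
move=> fl; rewrite -(cvg_shiftn p).
by under eq_fun do rewrite addnK.
Qed.

Lemma ccvg_subn u (l : R[i]) p : ccvg u l -> ccvg (fun n => u (n - p)%N) l.
Proof. by move=> [u1 u2]; split; [exact: (cvg_subn p u1)|exact: (cvg_subn p u2)]. Qed.

Lemma ccvg_unique u (l l' : R[i]) : ccvg u l -> ccvg u l' -> l = l'.
Proof.
move=> [u1 u2] [v1 v2]; apply/eqP; rewrite eq_complex.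
rewrite (cvg_unique (@Rhausdorff R) u1 v1) (cvg_unique (@Rhausdorff R) u2 v2).
by rewrite !eqxx.
Qed.

Definition sin_series a th : R := limn (series (fun l => a l * sin (l%:R * th))).

Definition power_sum a th : R[i] := cos_series a th +i* sin_series a th.

Lemma ccvg_power_sum a th : cvgn (series (fun l => `|a l|)) ->
  ccvg (fun n => \sum_(l < n) (a l)%:C * cis th ^+ l) (power_sum a th).
Proof.
move=> ca; have [S [HS _]] := cvgn_abs_sum ca.
have ReE n : complex.Re (\sum_(l < n) (a l)%:C * cis th ^+ l) =
    series (fun l => a l * cos (l%:R * th)) n.
  rewrite seriesE (raddf_sum (@complex.Re R : Rcomplex R -> R)) /=.
  by apply: eq_bigr => l _; rewrite cisX /= mul0r subr0.
have ImE n : complex.Im (\sum_(l < n) (a l)%:C * cis th ^+ l) =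
    series (fun l => a l * sin (l%:R * th)) n.
  rewrite seriesE (raddf_sum (@complex.Im R : Rcomplex R -> R)) /=.
  by apply: eq_bigr => l _; rewrite cisX /= mul0r addr0.
split; [under eq_fun do rewrite ReE|under eq_fun do rewrite ImE] => /=.
  exact: cos_series_cvg.
apply: (@cvgn_series_bounded _ _ S) => n; apply: le_trans (HS n).
by apply: ler_sum => l _; rewrite normrM -[leRHS]mulr1 ler_wpM2l //; exact: sin_max.
Qed.

Lemma power_sum_conv q a K th : (forall p, (K <= p)%N -> q p = 0) ->
  cvgn (series (fun l => `|a l|)) -> cvgn (series (fun l => `|cauchy_prod q a l|)) ->
  power_sum (cauchy_prod q a) th = (\sum_(p < K) (q p)%:C * cis th ^+ p) * power_sum a th.
Proof.
move=> qK ca cqa; apply: ccvg_unique (ccvg_power_sum th cqa) _.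
have -> : (fun n => \sum_(l < n) (cauchy_prod q a l)%:C * cis th ^+ l) =
    (fun n => \sum_(p < K) ((q p)%:C * cis th ^+ p) *
       \sum_(i < n - p) (a i)%:C * cis th ^+ i).
  apply/funext => n; rewrite -(@sum_conv _ (fun p => (q p)%:C * cis th ^+ p)
    (fun i => (a i)%:C * cis th ^+ i)); last by move=> p Kp; rewrite qK // rmorph0 mul0r.
  apply: eq_bigr => l _; rewrite conv_geometric; congr (_ * _).
  by rewrite /cauchy_prod rmorph_sum; apply: eq_bigr => p _; rewrite rmorphM.
rewrite mulr_suml.
apply: (@ccvg_sum K (fun p n => (q p)%:C * cis th ^+ p * \sum_(i < n - p) (a i)%:C * cis th ^+ i)
  (fun p => (q p)%:C * cis th ^+ p * power_sum a th)) => p; apply: ccvgMl.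
exact: (ccvg_subn p (ccvg_power_sum th ca)).
Qed.

End ComplexLimits.

(** * Products of Chebyshev series with polynomials *)

Section ChebyshevSeries.
Variable R : realType.
Implicit Types (a w : nat -> R) (th x : R).

Lemma sin_series_cvg a th : cvgn (series (fun l => `|a l|)) ->
  series (fun l => a l * sin (l%:R * th)) @ \oo --> sin_series a th.
Proof.
move=> /cvgn_abs_sum[S [HS _]]; apply: (@cvgn_series_bounded _ _ S) => n.
apply: le_trans (HS n).
by apply: ler_sum => l _; rewrite normrM -[leRHS]mulr1 ler_wpM2l //; exact: sin_max.
Qed.

Lemma cvg_series_shift (f : nat -> R) (l : R) N : (forall i, (i < N)%N -> f i = 0) ->
  series f @ \oo --> l -> series (fun i => f (N + i)%N) @ \oo --> l.
Proof.
move=> fN fl; rewrite -(cvg_shiftn N) in fl.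
have -> : series (fun i => f (N + i)%N) = (fun n => series f (n + N)%N); last exact: fl.
apply/funext => n; rewrite !seriesE [(n + N)%N]addnC big_split_ord /=.
by rewrite [X in _ = X + _]big1 ?add0r // => i _; exact: fN.
Qed.

(* Coefficients of the product T_p * \sum_l a_l T_l, from
   2 T_p T_l = T_(l + p) + T_(l - p), when a_l = 0 for l < p. *)
Definition cheb_mul a p l : R := ((if (p <= l)%N then a (l - p)%N else 0) + a (l + p)%N) / 2.

(** If C and S are the cosine and sine series of [a], its shifts by [p] upwards and downwards sum to
    c C - s S and c C + s S; the mean of these is c C. *)
Lemma cheb_mul_cvg a p th : (forall i, (i < p)%N -> a i = 0) ->
  cvgn (series (fun l => `|a l|)) ->
  series (fun l => cheb_mul a p l * cos (l%:R * th)) @ \oo -->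
  cos (p%:R * th) * cos_series a th.
Proof.
move=> ap ca; set c := cos (p%:R * th); set s := sin (p%:R * th).
have Cc : series (fun l => a l * cos (l%:R * th)) @ \oo --> cos_series a th.
  exact: cos_series_cvg.
have Cs := @sin_series_cvg a th ca.
have C1 : (fun n => c * series (fun l => a l * cos (l%:R * th)) n -
    s * series (fun l => a l * sin (l%:R * th)) n) @ \oo -->
    c * cos_series a th - s * sin_series a th.
  by apply: cvgB; apply: cvgM => //; exact: cvg_cst.
have C2 : (fun n => c * series (fun l => a l * cos (l%:R * th)) n +
    s * series (fun l => a l * sin (l%:R * th)) n) @ \oo -->
    c * cos_series a th + s * sin_series a th.
  by apply: cvgD; apply: cvgM => //; exact: cvg_cst.
have E1 n : c * series (fun l => a l * cos (l%:R * th)) n -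
    s * series (fun l => a l * sin (l%:R * th)) n =
    \sum_(i < n) a i * cos ((i + p)%:R * th).
  rewrite !seriesE !mulr_sumr -sumrB; apply: eq_bigr => i _.
  by rewrite natrD mulrDl cosD /c /s; ring.
(* Truncated subtraction is harmless here because [a i = 0] for [i < p]. *)
have E2 n : c * series (fun l => a l * cos (l%:R * th)) n +
    s * series (fun l => a l * sin (l%:R * th)) n =
    series (fun i => a i * cos ((i - p)%:R * th)) n.
  rewrite !seriesE !mulr_sumr -big_split /=; apply: eq_bigr => i _.
  case: (ltnP i p) => [/ap ->|pi]; first by rewrite !mul0r !mulr0 addr0.
  by rewrite natrB // mulrBl cosB /c /s; ring.
have {}E1 : (fun n => c * series (fun l => a l * cos (l%:R * th)) n -
    s * series (fun l => a l * sin (l%:R * th)) n) =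
    (fun n => \sum_(i < n) a i * cos ((i + p)%:R * th)) by apply/funext.
have {}E2 : (fun n => c * series (fun l => a l * cos (l%:R * th)) n +
    s * series (fun l => a l * sin (l%:R * th)) n) =
    series (fun i => a i * cos ((i - p)%:R * th)) by apply/funext.
rewrite E1 in C1; rewrite E2 in C2.
have {}C1 := cvg_subn p C1.
have {}C2 : series (fun i => a (p + i)%N * cos ((p + i - p)%:R * th)) @ \oo -->
    c * cos_series a th + s * sin_series a th.
  by apply: (cvg_series_shift _ C2) => i /ap ->; rewrite mul0r.
have -> : c * cos_series a th = (c * cos_series a th - s * sin_series a th +
  (c * cos_series a th + s * sin_series a th)) / 2 by field.
have -> : series (fun l => cheb_mul a p l * cos (l%:R * th)) =
  (fun n => (\sum_(i < n - p) a i * cos ((i + p)%:R * th) +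
    series (fun i => a (p + i)%N * cos ((p + i - p)%:R * th)) n) / 2).
  apply/funext => n; rewrite !seriesE.
  have -> : \sum_(i < n - p) a i * cos ((i + p)%:R * th) =
      \sum_(l < n) (if (p <= l)%N then a (l - p)%N else 0) * cos (l%:R * th).
    elim: n => [|n IH]; first by rewrite sub0n !big_ord0.
    rewrite big_ord_recr /= -IH; case: leqP => pn.
      by rewrite subSn // big_ord_recr /= subnK.
    by rewrite mul0r addr0; have -> : (n.+1 - p = n - p)%N by move: pn; lia.
  rewrite -big_split mulr_suml /=; apply: eq_bigr => l _.
  by rewrite addKn /cheb_mul [(p + l)%N]addnC; ring.
by apply: cvgM; [exact: cvgD|exact: cvg_cst].
Qed.

(* If \sum_p w_p T_p times a series starting with T_N still starts with T_N,
   then w is constant: the product has the coefficient w_d a_N / 2 at T_(N - d)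
   when d is the degree of w. *)
Lemma cheb_tail_factor a w (a' : nat -> R) (M N : nat) : (M < N)%N ->
  (forall i, (i < N)%N -> a i = 0) -> a N != 0 ->
  cvgn (series (fun l => `|a l|)) ->
  (forall x, -1 <= x <= 1 -> series (fun l => a' l * chebT (N + l) x) @ \oo -->
     (\sum_(p < M.+1) w p * chebT p x) * cos_series a (acos x)) ->
  forall d, (0 < d <= M)%N -> w d = 0.
Proof.
move=> MN aN aN0 ca H.
pose b l := \sum_(p < M.+1) w p * cheb_mul a p l.
pose c l := b l - (if (l < N)%N then 0 else a' (l - N)%N).
have c0 : forall l, c l = 0.
  apply: chebT_series_eq0 => x x1; set th := acos x.
  pose T := (\sum_(p < M.+1) w p * chebT p x) * cos_series a th.
  have B : series (fun l => b l * chebT l x) @ \oo --> T.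
    have -> : series (fun l => b l * chebT l x) = (fun n => \sum_(p < M.+1)
        w p * series (fun l => cheb_mul a p l * cos (l%:R * th)) n).
      apply/funext => n; rewrite seriesE.
      under [RHS]eq_bigr do rewrite seriesE mulr_sumr.
      rewrite exchange_big /=; apply: eq_bigr => l _.
      by rewrite /b mulr_suml; apply: eq_bigr => p _; rewrite mulrA.
    rewrite /T mulr_suml; apply: cvg_sumE => p; rewrite -mulrA.
    apply: cvgM; first exact: cvg_cst.
    apply: cheb_mul_cvg => // i ip; apply: aN.
    by rewrite (ltn_trans ip) // (leq_trans _ MN) // ltnS -ltnS ltn_ord.
  have A : series (fun l => (if (l < N)%N then 0 else a' (l - N)%N) * chebT l x) @ \oo --> T.
    have {}H := H x x1; rewrite -(cvg_shiftn N).
    rewrite [X in X @ _ --> _](_ : _ = series (fun l => a' l * chebT (N + l) x)) //.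
    apply/funext => n /=; rewrite !seriesE addnC big_split_ord /= big1 ?add0r => [|i _].
      by apply: eq_bigr => i _; rewrite ltnNge leq_addr /= addKn.
    by rewrite ltn_ord mul0r.
  have C : (fun n => series (fun l => b l * chebT l x) n - series (fun l =>
      (if (l < N)%N then 0 else a' (l - N)%N) * chebT l x) n) @ \oo --> T - T.
    exact: cvgB.
  rewrite subrr in C; rewrite [X in X @ _ --> _](_ : _ = (fun n =>
    series (fun l => b l * chebT l x) n - series (fun l =>
      (if (l < N)%N then 0 else a' (l - N)%N) * chebT l x) n)) //.
  apply/funext => n; rewrite !seriesE -sumrB.
  by apply: eq_bigr => l _; rewrite /c mulrBl.
(* Downward induction on d = M - i: at T_(N - d) the terms with p > d vanish by induction, those
   with p < d because [a] starts at N. *)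
suff H' i : (i < M)%N -> w (M - i)%N = 0.
  by move=> d /andP[d0 dM]; rewrite -(subKn dM) H' // ltn_subrL d0 (leq_trans d0).
elim/ltn_ind: i => i IH iM.
set d := (M - i)%N; have dM : (d < M.+1)%N by rewrite ltnS leq_subr.
have d0 : (0 < d)%N by rewrite subn_gt0.
have := c0 (N - d)%N; rewrite /c /b ltn_subrL d0 (leq_trans _ MN) //= subr0.
rewrite (bigD1 (Ordinal dM)) //= big1 ?addr0 => [|p pd]; last first.
  rewrite /cheb_mul.
  have -> : (if (p <= N - d)%N then a (N - d - p)%N else 0) = 0.
    by case: ifP => // _; apply: aN; lia.
  case: (ltngtP p d) => [lt|gt|eq].
  - by rewrite [a _]aN ?addr0 ?mul0r ?mulr0 //; lia.
  - have -> : (p : nat) = (M - (M - p))%N by have := ltn_ord p; lia.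
    by rewrite IH ?mul0r //; have := ltn_ord p; lia.
  - by move: pd; rewrite -val_eqE /= eq eqxx.
rewrite /cheb_mul.
have -> : (if (d <= N - d)%N then a (N - d - d)%N else 0) = 0.
  by case: ifP => // _; apply: aN; lia.
have -> : (N - d + d = N)%N by lia.
move=> /eqP; rewrite add0r !mulf_eq0 (negbTE aN0) invr_eq0 pnatr_eq0 /= orbF.
by move/eqP.
Qed.

End ChebyshevSeries.

Section NonvanishingRemainder.
Variable R : realType.
Implicit Types (s t : R).

(* \sum_p w_p x^(s+p) / (s+p) is a primitive of t^(s-1) w(t) vanishing at 0; by
   the mean value theorem it cannot vanish at x if w has no zero in ]0, x[. *)
Lemma primitive_neq0 s (x : R) (w : {poly R}) : 0 < s -> 0 < x ->
  (forall t, 0 < t < x -> w.[t] != 0) ->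
  \sum_(p < size w) w`_p * x ^+ p / (s + p%:R) != 0.
Proof.
move=> s0 x0 w0.
have sp (p : nat) : 0 < s + p%:R by apply: lt_le_trans s0 _; rewrite lerDl.
pose G t := \sum_(p < size w) w`_p / (s + p%:R) * t `^ (s + p%:R).
have dG t : 0 < t -> is_derive t 1 G (\sum_(p < size w) w`_p * t `^ (s + p%:R - 1)).
  move=> t0; apply: (@is_derive_sumE R 'I_(size w) (index_enum _)
    (fun p t => w`_p / (s + p%:R) * t `^ (s + p%:R))
    (fun p => w`_p * t `^ (s + p%:R - 1))) => p.
  have := is_deriveME (is_derive_cstE (w`_p / (s + p%:R)) t) (is_derive1_powR (s + p%:R) t0).
  rewrite mul0r add0r => d; apply: is_derive_eq d _.
  by field; rewrite gt_eqF.
have G0 : G 0 = 0.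
  by rewrite /G big1 // => p _; rewrite powR0 ?mulr0 // gt_eqF.
have cG : {within `[0, x], continuous G}.
  apply/continuous_within_itvP => //; split.
  - by move=> t; rewrite in_itv /= => /andP[t0 _]; apply: is_derive_continuous (dG t t0).
  - have Z : \sum_(p < size w) w`_p / (s + p%:R) * 0 = 0 :> R.
      by rewrite big1 // => p _; rewrite mulr0.
    have C : (fun t => \sum_(p < size w) w`_p / (s + p%:R) * t `^ (s + p%:R)) @ 0^'+ -->
        \sum_(p < size w) w`_p / (s + p%:R) * 0.
      apply: (@cvg_sumE R 'I_(size w) (index_enum _) R 0^'+ _
        (fun p t => w`_p / (s + p%:R) * t `^ (s + p%:R))
        (fun p => w`_p / (s + p%:R) * 0)) => p.
      by apply: cvgM; [exact: cvg_cst|exact: powR_cvg0].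
    by rewrite Z in C; rewrite G0.
  - by apply: cvg_at_left_filter; apply: is_derive_continuous (dG x x0).
have dG' t : t \in `]0, x[ -> is_derive t 1 G (\sum_(p < size w) w`_p * t `^ (s + p%:R - 1)).
  by rewrite in_itv /= => /andP[t0 _]; exact: dG.
have [c] := MVT x0 dG' cG.
rewrite in_itv /= => /andP[c0 cx]; rewrite G0 !subr0 => E.
have Ec : \sum_(p < size w) w`_p * c `^ (s + p%:R - 1) = c `^ (s - 1) * w.[c].
  rewrite horner_coef mulr_sumr; apply: eq_bigr => p _.
  have -> : s + p%:R - 1 = s - 1 + p%:R by ring.
  rewrite powRD; last by rewrite (gt_eqF c0) implybT.
  by rewrite powR_mulrn ?ltW // mulrCA.
have : G x != 0.
  rewrite E Ec; apply: mulf_neq0; last by rewrite gt_eqF.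
  by apply: mulf_neq0; [rewrite gt_eqF ?powR_gt0|apply: w0; apply/andP].
apply: contraNneq => S0; rewrite /G.
have -> : \sum_(p < size w) w`_p / (s + p%:R) * x `^ (s + p%:R) =
    x `^ s * \sum_(p < size w) w`_p * x ^+ p / (s + p%:R).
  rewrite mulr_sumr; apply: eq_bigr => p _.
  rewrite powRD; last by rewrite (gt_eqF x0) implybT.
  by rewrite powR_mulrn ?ltW //; field; rewrite gt_eqF.
by rewrite S0 mulr0.
Qed.

End NonvanishingRemainder.

(** * Nonlinear approximations *)

Section CosineProducts.
Variable R : realType.
Implicit Types (A B : nat -> R) (P Q : {poly R}) (th x : R).

Lemma cis_conjX th (p r : nat) :
  complex.Re (cis th ^+ p * (cis th ^+ r)^*) = cos ((p - r + (r - p))%:R * th).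
Proof.
rewrite !cisX /= mulrN opprK.
case: (leqP p r) => pr.
  have -> : (p - r + (r - p) = r - p)%N by lia.
  by rewrite natrB // mulrBl cosB; ring.
have -> : (p - r + (r - p) = p - r)%N by lia.
by rewrite natrB ?(ltnW pr) // mulrBl cosB.
Qed.

(** On the unit circle Re(z^p conj(z^r)) = cos (|p - r| th), so the product of two factors of degree
    at most [D] has cosines only up to [D], not up to 2 D. *)
Definition cos_coef D A B (d : nat) : R :=
  \sum_(p < D.+1) \sum_(r < D.+1)
    (if (p - r + (r - p))%N == d then A p * B r else 0).

Lemma Re_mul_conj D A B th :
  complex.Re ((\sum_(p < D.+1) (A p)%:C * cis th ^+ p) *
    (\sum_(r < D.+1) (B r)%:C * cis th ^+ r)^*) =
  \sum_(d < D.+1) cos_coef D A B d * cos (d%:R * th).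
Proof.
rewrite rmorph_sum mulr_suml (raddf_sum (@complex.Re R : Rcomplex R -> R)) /=.
under eq_bigr do rewrite mulr_sumr (raddf_sum (@complex.Re R : Rcomplex R -> R)) /=.
rewrite /cos_coef.
under [RHS]eq_bigr do rewrite mulr_suml.
rewrite [RHS]exchange_big /=; apply: eq_bigr => p _.
under [RHS]eq_bigr do rewrite mulr_suml.
rewrite [RHS]exchange_big /=; apply: eq_bigr => r _.
have pD : (p - r + (r - p) < D.+1)%N by have := ltn_ord p; have := ltn_ord r; lia.
rewrite (bigD1 (Ordinal pD)) //= eqxx big1 ?addr0; last first.
  by move=> d; rewrite -val_eqE /= eq_sym => /negbTE ->; rewrite mul0r.
have -> : (A p)%:C * cis th ^+ p * ((B r)%:C * cis th ^+ r)^* =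
    (A p * B r)%:C * (cis th ^+ p * (cis th ^+ r)^*).
  case: (cis th ^+ p) (cis th ^+ r) => b1 b2 [c1 c2].
  by apply/eqP; rewrite eq_complex /=; apply/andP; split; apply/eqP; ring.
by rewrite -cis_conjX; case: (_ * _^*) => c1 c2 /=; rewrite mul0r subr0.
Qed.

Lemma chebsum_real D (c : nat -> R) x :
  chebsum D (fun d => (c d)%:C) x = (\sum_(d < D.+1) c d * cos (d%:R * acos x))%:C.
Proof. by rewrite /chebsum rmorph_sum; apply: eq_bigr => d _; rewrite rmorphM. Qed.

Lemma horner_cis Q D th : (size Q <= D.+1)%N ->
  (map_poly (real_complex R) Q).[cis th] = \sum_(p < D.+1) (Q`_p)%:C * cis th ^+ p.
Proof.
move=> sQ; rewrite (horner_coef_wide (n := D.+1)); last by rewrite size_map_poly.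
by apply: eq_bigr => p _; rewrite coef_map.
Qed.

Lemma complex_real_eq (z : R[i]) : complex.Im z = 0 -> (complex.Re z)%:C = z.
Proof. by case: z => a b /= ->. Qed.

End CosineProducts.

Section SmallDenominator.
Variables (R : realType) (k : nat) (g : R) (lam : 'I_k -> R) (m : 'I_k -> nat).
Hypothesis g_ok : forall p : nat, g != - p%:R.

Lemma rising_ge (x : R) p : 1 <= x -> x <= rising x p.+1.
Proof.
move=> x1; elim: p => [|p IH]; first by rewrite /rising big_ord_recr big_ord0 /= mul1r addr0.
rewrite /rising big_ord_recr /= -/(rising x p.+1); apply: le_trans IH _.
have r0 : 0 <= rising x p.+1 by apply: prodr_ge0 => i _; rewrite addr_ge0 //; lra.
rewrite -[leLHS]mulr1 ler_wpM2l //.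
by apply: le_trans x1 _; rewrite lerDl.
Qed.

Lemma eventually_small_denominator : exists n0 : nat, forall n, (n0 <= n)%N ->
  1 < n%:R + g /\
  \sum_(p < mtot m) `|(nodal_denominator g lam m n)`_p.+1| <= 2^-1.
Proof.
pose W : R := \sum_(p < mtot m) `|(nodal lam m)`_(mtot m - p.+1)|.
have W0 : 0 <= W by exact: sumr_ge0.
(* This gives n + g > 2 W + 2. The coefficient of [denom] at p + 1 is w_(M-p-1) divided by a rising
   factorial that is at least n + g, so the sum is at most W / (n + g) <= 1/2. *)
exists (Num.bound (2 * W + 2 + `|g|)) => n nb.
have b0 : 0 <= 2 * W + 2 + `|g| by rewrite !addr_ge0 ?mulr_ge0.
have ng : 2 * W + 2 < n%:R + g.
  have : 2 * W + 2 + `|g| < n%:R.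
    by apply: lt_le_trans (archi_boundP b0) _; rewrite ler_nat.
  by have := ler_norm (- g); rewrite normrN; lra.
split; first by lra.
have s0 : 0 < n%:R + g by lra.
apply: (@le_trans _ _ (\sum_(p < mtot m) `|(nodal lam m)`_(mtot m - p.+1)| / (n%:R + g))).
  apply: ler_sum => p _; rewrite coef_poly ltnS ltn_ord -mulrA normrM ler_wpM2l //.
  have pM := ltn_ord p.
  have E : (n + mtot m = n + mtot m - p.+1 + p.+1)%N by lia.
  rewrite [X in _ / rising _ X]E risingD invfM mulrA divff ?rising_neq0 // mul1r.
  set x := g + _.
  have xn : n%:R + g <= x.
    by rewrite /x addrC lerD2l ler_nat; lia.
  have x1 : 1 <= x by lra.
  have rx := rising_ge p x1.
  have r0 : 0 < rising x p.+1 by lra.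
  by rewrite normfV gtr0_norm // lef_pV2 ?posrE //; lra.
rewrite -mulr_suml -/W ler_pdivrMr //; lra.
Qed.

End SmallDenominator.

Section NonlinearApproximation.
Variables (R : realType) (k : nat) (g : R) (lam : 'I_k -> R) (m : 'I_k -> nat) (n : nat).
Hypothesis g_ok : forall p : nat, g != - p%:R.
Hypothesis lam_inj : injective lam.
Hypothesis lam_neq0 : forall j, lam j != 0.
Hypothesis m_le : forall j, (m j <= n)%N.
Hypothesis q_small :
  \sum_(p < mtot m) `|(nodal_denominator g lam m n)`_p.+1| <= 2^-1.

Notation M := (mtot m).
Notation N := (n + M + 1)%N.
Definition denom : {poly R} := nodal_denominator g lam m n.
Let q (p : nat) : R := denom`_p.
Let phi j := Defs.coefE g (lam j).

Lemma m_le_mtot j : (m j <= M)%N.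
Proof. by rewrite /mtot (bigD1 j) //= leq_addr. Qed.

Lemma q0 : q 0 = 1. Proof. exact: nodal_denominator0. Qed.

Lemma q_eq0 p : (M < p)%N -> q p = 0.
Proof. by move=> Mp; rewrite /q coef_poly ltnS leqNgt Mp. Qed.

Lemma conv_phi_eq0 j l : (nj n m j < l)%N -> (l < N)%N -> cauchy_prod q (phi j) l = 0.
Proof.
rewrite /nj => nl lN; have mj := m_le_mtot j.
have sq : (size denom <= M.+1)%N by exact: size_nodal_denominator.
have [_] := reverse_weight_dvdP g_ok lam_inj lam_neq0 m_le sq.
rewrite /denom reverse_weight_nodal // => /(_ (dvdpp _) j (n + M - l)%N).
have -> : (n + M - (n + M - l) = l)%N by lia.
by apply; lia.
Qed.

Definition numer j : {poly R} := \poly_(l < (nj n m j).+1) cauchy_prod q (phi j) l.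

Let e j l : R := cauchy_prod q (phi j) l - (numer j)`_l.

Lemma e_eq0 j l : (l < N)%N -> e j l = 0.
Proof.
move=> lN; rewrite /e coef_poly ltnS; case: leqP => nl; first by rewrite subrr.
by rewrite conv_phi_eq0 // subr0.
Qed.

Lemma eN j : e j N = cauchy_prod q (phi j) N.
Proof. by rewrite /e coef_poly ltnS ifF ?subr0 // /nj; apply/negbTE; rewrite -ltnNge; lia. Qed.

Lemma phi_abs_cvg j : cvgn (series (fun l => `|phi j l|)).
Proof. exact: coefE_abs_cvg. Qed.

Lemma conv_phi_abs_cvg j : cvgn (series (fun l => `|cauchy_prod q (phi j) l|)).
Proof.
have [S [HS _]] := cvgn_abs_sum (@phi_abs_cvg j).
apply: (@cvgn_series_abs _ _ ((\sum_(p < M.+1) `|q p|) * S)) => i.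
apply: le_trans (sum_norm_conv_le (phi j) i q_eq0) _.
by apply: ler_wpM2l; [exact: sumr_ge0|exact: HS].
Qed.

Lemma e_abs_cvg j : cvgn (series (fun l => `|e j l|)).
Proof.
have [S [HS _]] := cvgn_abs_sum (@conv_phi_abs_cvg j).
apply: (@cvgn_series_abs _ _ S) => i; apply: le_trans (HS i).
apply: ler_sum => l _; rewrite /e coef_poly; case: ifP => _; last by rewrite subr0.
by rewrite subrr normr0.
Qed.

(** The constant term 1 dominates the other terms, whose sum is at most 1/2 in modulus on the unit
    circle. *)
Lemma denom_neq0 th : (map_poly (real_complex R) denom).[cis th] != 0.
Proof.
rewrite (horner_cis _ (D := M)) ?size_nodal_denominator //.
rewrite big_ord_recl /= -/(q 0) q0 mul1r; apply: contraTneq q_small => Z.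
have E : \sum_(i < M) (denom`_(bump 0 i))%:C * cis th ^+ bump 0 i = - 1.
  by apply/eqP; rewrite -addr_eq0 addrC Z.
have nc : `|cis th| = 1 :> R[i].
  by apply/eqP; rewrite -(@eqrXn2 _ 2) // expr1n sqr_normc cis_conj.
have : `|\sum_(i < M) (denom`_(bump 0 i))%:C * cis th ^+ bump 0 i| <=
    (\sum_(p < M) `|denom`_p.+1|)%:C.
  apply: le_trans (ler_norm_sum _ _ _) _; rewrite rmorph_sum; apply: ler_sum => i _.
  rewrite normrM normrX nc expr1n mulr1 normc_def /= expr0n addr0 sqrtr_sqr.
  by rewrite /bump leq0n add1n.
rewrite E normrN normr1 -[1]/((1 : R)%:C) lecR => H.
by rewrite -ltNge; apply: lt_le_trans H; lra.
Qed.

(* The remainder has the Chebyshev coefficients of the Taylor expansion at 0 of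
   E_g(lam_j z) - P_j(z) / Q(z). *)
Lemma remainder_coef j : exists a : nat -> R,
  [/\ forall l, (l < N)%N -> a l = 0, a N = cauchy_prod q (phi j) N,
      cvgn (series (fun l => `|a l|)) &
      forall th, (map_poly (real_complex R) denom).[cis th] *
        (power_sum (phi j) th - power_sum a th) =
        (map_poly (real_complex R) (numer j)).[cis th]].
Proof.
(* The quotient by a series with constant term 1 starts at the same order as [e j], with the same
   first coefficient. *)
have [a aE] := exists_quotient (e j) q0.
have a0 l : (l < N)%N -> a l = 0.
  elim/ltn_ind: l => l IH lN.
  have := aE l; rewrite e_eq0 // /cauchy_prod big_ord_recl q0 mul1r subn0 big1 ?addr0 // => i _.
  by rewrite IH ?mulr0 // lift0; have := ltn_ord i; lia.
have ca : cvgn (series (fun l => `|a l|)).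
  apply: (quotient_abs_cvg q0 q_eq0 q_small).
  have -> : (fun l => `|cauchy_prod q a l|) = (fun l => `|e j l|) by apply/funext => l; rewrite aE.
  exact: e_abs_cvg.
exists a; split=> // [|th].
  have := aE N; rewrite eN /cauchy_prod big_ord_recl q0 mul1r subn0 big1 ?addr0 // => i _.
  by rewrite a0 ?mulr0 // lift0; have := ltn_ord i; lia.
have qK p : (M.+1 <= p)%N -> q p = 0 by exact: q_eq0.
have eE : cauchy_prod q a = e j by apply/funext.
have ce : cvgn (series (fun l => `|cauchy_prod q a l|)) by rewrite eE; exact: e_abs_cvg.
rewrite (horner_cis _ (D := M)) ?size_nodal_denominator // mulrBr.
rewrite -(power_sum_conv th qK (@phi_abs_cvg j) (@conv_phi_abs_cvg j)).
rewrite -(power_sum_conv th qK ca ce) eE; apply/eqP; rewrite subr_eq; apply/eqP.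
apply: ccvg_unique (ccvg_power_sum th (@conv_phi_abs_cvg j)) _.
have sP : (size (numer j) <= (nj n m j).+1)%N by exact: size_poly.
rewrite (horner_cis _ sP).
have [C1 C2] := ccvgD (ccvg_cst (\sum_(p < (nj n m j).+1) ((numer j)`_p)%:C * cis th ^+ p))
  (ccvg_power_sum th (@e_abs_cvg j)).
have E : \forall i \near \oo, \sum_(p < (nj n m j).+1) ((numer j)`_p)%:C * cis th ^+ p +
    \sum_(l < i) (e j l)%:C * cis th ^+ l = \sum_(l < i) (cauchy_prod q (phi j) l)%:C * cis th ^+ l.
  exists (nj n m j).+1 => // i /= ni.
  rewrite (big_ord_widen i (fun p => ((numer j)`_p)%:C * cis th ^+ p)) // big_mkcond -big_split /=.
  apply: eq_bigr => l _; rewrite /e rmorphB /= mulrBl coef_poly; case: (ltnP l (nj n m j).+1) => _.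
    by rewrite addrC subrK.
  by rewrite rmorph0 mul0r subr0 add0r.
split; [apply: cvg_trans C1|apply: cvg_trans C2]; apply: near_eq_cvg;
  by apply: filterS E => i ->.
Qed.

Definition hc_denom (d : nat) : R[i] := (cos_coef M q q d)%:C.
Definition hc_numer j (d : nat) : R[i] :=
  (cos_coef (nj n m j) (fun p => (numer j)`_p) q d)%:C.

Lemma chebsum_hc_denom x : chebsum M hc_denom x =
  (map_poly (real_complex R) denom).[cis (acos x)] *
  ((map_poly (real_complex R) denom).[cis (acos x)])^*.
Proof.
rewrite /hc_denom chebsum_real -Re_mul_conj -(horner_cis _ (size_nodal_denominator _ _ _ _)).
by apply: complex_real_eq; case: (_.[_]) => a b /=; ring.
Qed.

(** By this [nj] bounds the degrees of both P_j and Q, hence that of Re(P_j conj(Q)), as the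
    numerator requires. *)
Lemma mtot_le_nj j : (M <= nj n m j)%N.
Proof. by rewrite /nj; have := m_le j; have := m_le_mtot j; lia. Qed.

Lemma chebsum_hc_numer j x : chebsum (nj n m j) (hc_numer j) x =
  (complex.Re ((map_poly (real_complex R) (numer j)).[cis (acos x)] *
  ((map_poly (real_complex R) denom).[cis (acos x)])^*))%:C.
Proof.
rewrite /hc_numer chebsum_real -Re_mul_conj.
rewrite -(horner_cis (Q := numer j)) ?size_poly // -(horner_cis (Q := denom)) //.
by apply: leq_trans (size_nodal_denominator _ _ _ _) _; rewrite ltnS mtot_le_nj.
Qed.

Lemma chebsum_hc_denom_neq0 x : chebsum M hc_denom x != 0.
Proof. by rewrite chebsum_hc_denom mulf_neq0 ?conjc_eq0 ?denom_neq0. Qed.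

(** F_j is the real part of the power series E at e^(i th), and Q (E - A) = P with A the remainder
    series; multiplying by conj(Q), taking real parts and dividing by |Q|^2 leaves Re A. *)
Lemma hc_remainder j : exists a : nat -> R,
  [/\ forall l, (l < N)%N -> a l = 0, a N = cauchy_prod q (phi j) N,
      cvgn (series (fun l => `|a l|)) &
      forall x, (sysF g lam j x)%:C - chebsum (nj n m j) (hc_numer j) x / chebsum M hc_denom x =
        (cos_series a (acos x))%:C].
Proof.
have [a [a0 aN ca aE]] := remainder_coef j.
exists a; split=> // x; set th := acos x.
have fE : sysF g lam j x = complex.Re (power_sum (phi j) th) by [].
have D0 := chebsum_hc_denom_neq0 x.
rewrite chebsum_hc_numer -aE fE.
set Z := (map_poly _ denom).[_].
have -> : (complex.Re (Z * (power_sum (phi j) th - power_sum a th) * Z^*))%:C =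
    chebsum M hc_denom x * (complex.Re (power_sum (phi j) th - power_sum a th))%:C.
  rewrite chebsum_hc_denom -/th -/Z.
  case: Z => z1 z2; case: (power_sum _ _ - _) => w1 w2.
  by apply/eqP; rewrite eq_complex /=; apply/andP; split; apply/eqP; ring.
rewrite mulrAC divff // mul1r (raddfB (@complex.Re R : Rcomplex R -> R)) /= rmorphB /=.
by rewrite opprB addrC subrK.
Qed.

End NonlinearApproximation.

(** * The Hermite-Pade problem over the complex numbers *)

Section ComplexNodal.
Variables (R : realType) (k : nat) (g : R) (lam : 'I_k -> R) (m : 'I_k -> nat) (n : nat).

Lemma rising_complex (x : R) l : rising (x%:C) l = (rising x l)%:C.
Proof. by rewrite /rising rmorph_prod; apply: eq_bigr => i _; rewrite rmorphD /= rmorph_nat. Qed.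

Lemma nodal_complex : nodal (fun j => (lam j)%:C) m = map_poly (real_complex R) (nodal lam m).
Proof.
rewrite /nodal rmorph_prod; apply: eq_bigr => j _.
by rewrite rmorphXn /= map_polyXsubC.
Qed.

(** Links the uniqueness statement, which ranges over complex polynomials, to the estimates, which
    use real coefficients. *)
Lemma nodal_denominator_complex :
  nodal_denominator (g%:C) (fun j => (lam j)%:C) m n =
  map_poly (real_complex R) (nodal_denominator g lam m n).
Proof.
apply/polyP => p; rewrite coef_map /= !coef_poly; case: ifP => _ //.
by rewrite nodal_complex coef_map !rising_complex -fmorphV -!rmorphM.
Qed.

Hypothesis g_ok : forall p : nat, g != - p%:R.
Hypothesis lam_inj : injective lam.
Hypothesis lam_neq0 : forall j, lam j != 0.
Hypothesis m_le : forall j, (m j <= n)%N.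

Lemma sysE_rising j l : sysE g lam j l = (lam j)%:C ^+ l / rising (g%:C) l.
Proof. by rewrite /sysE /Defs.coefE rmorphM fmorphV rmorphXn rising_complex. Qed.

Lemma HP_denominatorP (Q : {poly R[i]}) : Q`_0 = 1 -> (size Q <= (mtot m).+1)%N ->
  HP_denominator (sysE g lam) n m Q <->
  nodal (fun j => (lam j)%:C) m %| reverse_weight (g%:C) m n Q.
Proof.
move=> Q0 sQ.
have gC p : g%:C != - p%:R :> R[i].
  rewrite -(rmorph_nat (real_complex R)) -rmorphN /=; apply: contra (g_ok p).
  by move=> /eqP[->].
have lC : injective (fun j => (lam j)%:C) by move=> i j [/lam_inj].
have l0 j : (lam j)%:C != 0 :> R[i] by rewrite fmorph_eq0.
have D := reverse_weight_dvdP gC lC l0 m_le sQ.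
have mM j : (m j <= mtot m)%N by exact: m_le_mtot.
split.
  move=> [_ _ H]; apply/D => j i ij; have [P [sP HP]] := H j.
  have := HP (n + mtot m - i)%N; rewrite [P`_ _]nth_default ?subr0; last first.
    by apply: leq_trans sP _; rewrite /nj; have := mM j; have := m_le j; lia.
  under eq_bigr do rewrite sysE_rising.
  by apply; lia.
move=> /D H; split=> // [|j]; first by apply: contra_eq_neq Q0 => ->; rewrite coef0 eq_sym oner_eq0.
exists (\poly_(l < (nj n m j).+1) \sum_(p < l.+1) Q`_p * sysE g lam j (l - p)); split.
  exact: size_poly.
move=> l lN; rewrite coef_poly ltnS; case: leqP => nl; first by rewrite subrr.
rewrite subr0; under eq_bigr do rewrite sysE_rising.
have := H j (n + mtot m - l)%N.
have -> : (n + mtot m - (n + mtot m - l) = l)%N by lia.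
by apply; rewrite /nj in nl; have := mM j; have := m_le j; lia.
Qed.

Lemma denom_unique :
  unique (normalized_HP_denominator (sysE g lam) n m) (map_poly (real_complex R) (denom g lam m n)).
Proof.
have gC p : g%:C != - p%:R :> R[i].
  rewrite -(rmorph_nat (real_complex R)) -rmorphN /=; apply: contra (g_ok p).
  by move=> /eqP[->].
rewrite /denom -nodal_denominator_complex.
have d0 := nodal_denominator0 (fun j => (lam j)%:C) m n gC.
split.
  split; last by rewrite horner_coef0.
  apply/HP_denominatorP => //; first exact: size_nodal_denominator.
  by rewrite reverse_weight_nodal.
move=> Q [HQ]; rewrite horner_coef0 => Q0.
have sQ : (size Q <= (mtot m).+1)%N by case: HQ.
by apply/esym/nodal_denominator_unique => //; apply/HP_denominatorP.
Qed.

End ComplexNodal.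

(** * A nonlinear approximation that is not linear *)

Section NotLinear.
Variables (R : realType) (k : nat) (g : R) (lam : 'I_k -> R) (m : 'I_k -> nat) (n : nat).
Hypothesis g_ok : forall p : nat, g != - p%:R.
Hypothesis lam_inj : injective lam.
Hypothesis lam_neq0 : forall j, lam j != 0.
Hypothesis m_le : forall j, (m j <= n)%N.
Hypothesis ng1 : 1 < n%:R + g.

(** One order beyond the Hermite-Pade conditions the quotient of rising factorials is 1 / (g + n +
    p): an Euler operator is inverted, which is an integration of t^(g+n-1) w(t) from 0 to lam_j,
    and w has no zero in between. *)
Lemma cauchy_prod_next_neq0 (j : 'I_k) : 0 < lam j ->
  (forall p : 'I_k, m p != 0%N -> lam j <= lam p) ->
  cauchy_prod (fun p => (denom g lam m n)`_p) (Defs.coefE g (lam j)) (n + mtot m + 1) != 0.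
Proof.
move=> lj0 ljmin.
rewrite /cauchy_prod (@sum_reverse_weight _ _ g m n g_ok); last 2 first.
- by rewrite addn1 leqW // leq_addl.
- exact: size_nodal_denominator.
rewrite /denom reverse_weight_nodal // mulf_neq0 ?invr_eq0 ?rising_neq0 //.
have -> : (n + mtot m + 1 - mtot m = n.+1)%N by lia.
have H : \sum_(p < size (nodal lam m)) (nodal lam m)`_p * lam j ^+ p / (g + n%:R + p%:R) != 0.
  have s0 : 0 < g + n%:R by rewrite addrC; apply: lt_trans ng1.
  apply: (primitive_neq0 s0 lj0) => t /andP[t0 tl]; rewrite /nodal horner_prod; apply/prodf_neq0 => p _.
  rewrite horner_exp hornerXsubC; case: (eqVneq (m p) 0%N) => [->|mp].
    by rewrite expr0 oner_eq0.
  by rewrite expf_neq0 // subr_eq0 lt_eqF // (lt_le_trans tl) // ljmin.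
rewrite size_nodal in H.
have -> : \sum_(p < (mtot m).+1) (nodal lam m)`_p * lam j ^+ (n.+1 + p) *
    (rising g (n + p) / rising g (n.+1 + p)) =
    lam j ^+ n.+1 * \sum_(p < (mtot m).+1) (nodal lam m)`_p * lam j ^+ p / (g + n%:R + p%:R).
  rewrite mulr_sumr; apply: eq_bigr => p _.
  have r0 := rising_neq0 g_ok (n + p).
  have r1 : g + n%:R + p%:R != 0 by rewrite -addrA -natrD addr_eq0 g_ok.
  have -> : rising g (n.+1 + p) = rising g (n + p) * (g + n%:R + p%:R).
    by rewrite addSn /rising big_ord_recr /= natrD addrA.
  by rewrite exprD; field; rewrite r0 r1.
by rewrite mulf_neq0 // expf_neq0.
Qed.

Hypothesis q_small :
  \sum_(p < mtot m) `|(nodal_denominator g lam m n)`_p.+1| <= 2^-1.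

Lemma not_linear (j : 'I_k) : 0 < lam j -> m j != 0%N ->
  (forall p : 'I_k, m p != 0%N -> lam j <= lam p) ->
  ~ exists (u' : nat -> R[i]) (v' : 'I_k -> nat -> R[i]),
      linear_HCh (sysF g lam) n m u' v' /\
      same_fraction n m j (hc_denom g lam m n) (hc_numer g lam m n) u' v'.
Proof.
move=> lj0 mj0 ljmin [u' [v' [[[d dM ud] lin] same]]].
have [a [a0 aN ca aE]] := hc_remainder g_ok lam_inj lam_neq0 m_le q_small j.
have aN0 : a (n + mtot m + 1)%N != 0 by rewrite aN; exact: cauchy_prod_next_neq0.
have D0 x := chebsum_hc_denom_neq0 g_ok q_small x.
(* the linear remainder is the nonlinear one times the linear denominator *)
have rem x : -1 <= x <= 1 ->
    chebsum (mtot m) u' x * (sysF g lam j x)%:C - chebsum (nj n m j) (v' j) x =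
    chebsum (mtot m) u' x * (cos_series a (acos x))%:C.
  move=> x1; rewrite -aE mulrBr; congr (_ - _).
  apply: (mulIf (D0 x)); rewrite -(same x x1) -mulrA divfK //; ring.
have [a' Ha'] := lin j.
have chebsumRe x : complex.Re (chebsum (mtot m) u' x) =
    \sum_(p < (mtot m).+1) complex.Re (u' p) * chebT p x.
  rewrite /chebsum (raddf_sum (@complex.Re R : Rcomplex R -> R)) /=.
  by apply: eq_bigr => p _; case: (u' p) => b1 b2 /=; rewrite mulr0 subr0.
have chebsumIm x : complex.Im (chebsum (mtot m) u' x) =
    \sum_(p < (mtot m).+1) complex.Im (u' p) * chebT p x.
  rewrite /chebsum (raddf_sum (@complex.Im R : Rcomplex R -> R)) /=.
  by apply: eq_bigr => p _; case: (u' p) => b1 b2 /=; rewrite mulr0 add0r.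
have MN : (mtot m < n + mtot m + 1)%N by rewrite addn1 ltnS leq_addl.
(* As [a] is real, the real and imaginary parts of [u'] obey the same factorization separately. *)
have uRe : forall d, (0 < d <= mtot m)%N -> complex.Re (u' d) = 0.
  apply: (@cheb_tail_factor _ a (fun p => complex.Re (u' p)) (fun l => complex.Re (a' (n + mtot m + 1 + l)%N))
     _ _ MN a0 aN0 ca) => x x1.
  have [H _] := Ha' x x1; rewrite rem // in H; rewrite -chebsumRe.
  have -> : complex.Re (chebsum (mtot m) u' x) * cos_series a (acos x) =
     complex.Re (chebsum (mtot m) u' x * (cos_series a (acos x))%:C).
    by case: (chebsum _ _ _) => b1 b2 /=; rewrite mulr0 subr0.
  rewrite [X in X @ _ --> _](_ : _ = series (fun l => complex.Re (a' (n + mtot m + 1 + l)%N *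
    (chebT (n + mtot m + 1 + l) x)%:C))) //.
  congr series; apply/funext => l; case: (a' _) => b1 b2 /=; by rewrite mulr0 subr0.
have uIm : forall d, (0 < d <= mtot m)%N -> complex.Im (u' d) = 0.
  apply: (@cheb_tail_factor _ a (fun p => complex.Im (u' p)) (fun l => complex.Im (a' (n + mtot m + 1 + l)%N))
     _ _ MN a0 aN0 ca) => x x1.
  have [_ H] := Ha' x x1; rewrite rem // in H; rewrite -chebsumIm.
  have -> : complex.Im (chebsum (mtot m) u' x) * cos_series a (acos x) =
     complex.Im (chebsum (mtot m) u' x * (cos_series a (acos x))%:C).
    by case: (chebsum _ _ _) => b1 b2 /=; rewrite mulr0 add0r.
  rewrite [X in X @ _ --> _](_ : _ = series (fun l => complex.Im (a' (n + mtot m + 1 + l)%N *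
    (chebT (n + mtot m + 1 + l) x)%:C))) //.
  congr series; apply/funext => l; case: (a' _) => b1 b2 /=; by rewrite mulr0 add0r.
have u0 p : (0 < p <= mtot m)%N -> u' p = 0.
  by move=> hp; apply/eqP; rewrite eq_complex uRe // uIm // !eqxx.
have u00 : u' 0%N != 0.
  by case: (posnP d) => [<-//|d0]; move: ud; rewrite u0 ?eqxx // d0.
have chebsum0 x : chebsum (mtot m) u' x = u' 0%N.
  rewrite /chebsum big_ord_recl /= big1 ?addr0 => [|p _].
    by rewrite /chebT mul0r cos0 mulr1.
  by rewrite u0 ?mul0r // /bump leq0n add1n /= ltn_ord.
(* a constant denominator would make F_j a polynomial of degree < n + M up to
   terms of degree > n + M *)
pose y l := complex.Re (v' j l / u' 0%N).
pose c l := Defs.coefE g (lam j) l - a l - (if (l <= nj n m j)%N then y l else 0).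
suff c0 : forall l, c l = 0.
  (* This order lies below the start of [a] and, since [m j] is non-zero, above n_j; only the
     non-zero coefficient of F_j remains. *)
  have := c0 (n + mtot m)%N; rewrite /c a0 ?addn1 // ifF ?subr0; last first.
    by apply/negbTE; rewrite -ltnNge /nj; have := m_le_mtot m j; lia.
  by apply/eqP; rewrite mulf_neq0 ?invr_eq0 ?expf_neq0 // (rising_neq0 g_ok).
apply: chebT_series_eq0 => x x1.
have := rem x x1; rewrite chebsum0 => E.
have {}E : sysF g lam j x - cos_series a (acos x) = \sum_(p < (nj n m j).+1) y p * chebT p x.
  have : (sysF g lam j x)%:C - (cos_series a (acos x))%:C = chebsum (nj n m j) (v' j) x / u' 0%N.
    apply: (mulfI u00); rewrite mulrBr -E opprB addrC subrK mulrC divfK //.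
  rewrite -rmorphB /= => /(congr1 (@complex.Re R)) /= ->.
  rewrite /chebsum mulr_suml (raddf_sum (@complex.Re R : Rcomplex R -> R)) /=.
  apply: eq_bigr => p _; rewrite mulrAC /y.
  by case: (v' j p / u' 0%N) => b1 b2 /=; rewrite mulr0 subr0.
have C1 : series (fun l => Defs.coefE g (lam j) l * cos (l%:R * acos x)) @ \oo --> sysF g lam j x.
  have -> : sysF g lam j x = cos_series (Defs.coefE g (lam j)) (acos x) by [].
  have cphi := @coefE_abs_cvg R g (lam j) g_ok.
  exact: cos_series_cvg.
have C2 : series (fun l => a l * cos (l%:R * acos x)) @ \oo --> cos_series a (acos x).
  exact: cos_series_cvg.
have C3 : (fun i : nat => series (fun l => Defs.coefE g (lam j) l * cos (l%:R * acos x)) i -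
    series (fun l => a l * cos (l%:R * acos x)) i - \sum_(p < (nj n m j).+1) y p * chebT p x) @ \oo -->
    sysF g lam j x - cos_series a (acos x) - \sum_(p < (nj n m j).+1) y p * chebT p x.
  by apply: cvgB; [exact: cvgB|exact: cvg_cst].
rewrite E subrr in C3.
apply: cvg_trans C3; apply: near_eq_cvg.
exists (nj n m j).+1 => // i /= ni.
have -> : \sum_(p < (nj n m j).+1) y p * chebT p x =
    \sum_(0 <= l < i) (if (l <= nj n m j)%N then y l else 0) * chebT l x.
  rewrite (big_ord_widen i (fun p => y p * chebT p x)) // big_mkcond big_mkord.
  by apply: eq_bigr => l _; rewrite ltnS; case: ifP; rewrite ?mul0r.
rewrite /series /= -2!sumrB; apply: eq_bigr => l _.
by rewrite /c !mulrBl.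
Qed.

End NotLinear.

Theorem theorem6 (R : realType) (k : nat) (g : R) (lam : 'I_k -> R)
  (m : 'I_k -> nat)
  (k_gt0 : (0 < k)%N)
  (g_ok : forall p : nat, g != - p%:R)
  (lam_inj : injective lam)
  (lam_neq0 : forall j, lam j != 0)
  (m_neq0 : exists j, m j != 0%N) :
  exists n0 : nat, forall n : nat, (n0 <= n)%N -> (forall j, (m j <= n)%N) ->
  exists2 Q : {poly R[i]},
    unique (normalized_HP_denominator (sysE g lam) n m) Q &
  exists (u : nat -> R[i]) (v : 'I_k -> nat -> R[i]),
  [/\ nonlinear_HCh (sysF g lam) n m u v,
      forall x : R, -1 <= x <= 1 ->
        chebsum (mtot m) u x =
        Q.[cexp (0 +i* acos x)] * (Q.[cexp (0 +i* acos x)])^*,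
      forall x : R, 0 < x <= 1 ->
        let h (t : R) : R[i] := (U g lam n m t)%:C *
          cexp (- t%:C * (x +i* Num.sqrt (1 - x ^+ 2))) in
        cintegrable `]0, +oo[ h /\
        chebsum (mtot m) u x =
        ((Gamma ((n + mtot m)%:R + g)) ^- 2)%:C * `|cintegral `]0, +oo[ h| ^+ 2 &
      (forall j, 0 < lam j) ->
      (forall i j : 'I_k, (i < j)%N -> lam i < lam j) ->
      exists j : 'I_k, ~ exists (u' : nat -> R[i]) (v' : 'I_k -> nat -> R[i]),
        linear_HCh (sysF g lam) n m u' v' /\ same_fraction n m j u v u' v'].
Proof.
have [n0 Hn0] := eventually_small_denominator lam m g_ok.
exists n0 => n n0n m_le; have [ng1 q_small] := Hn0 n n0n.
exists (map_poly (real_complex R) (denom g lam m n)); first exact: denom_unique.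
exists (hc_denom g lam m n), (hc_numer g lam m n); split.
- split=> [x _|j]; first exact: chebsum_hc_denom_neq0.
  have [a [a0 _ ca aE]] := hc_remainder g_ok lam_inj lam_neq0 m_le q_small j.
  exists (fun l => (a l)%:C) => x x1; rewrite aE; split => /=.
    under eq_fun do rewrite mulr0 subr0.
    apply: (cvg_series_shift (f := fun l => a l * chebT l x)) => [i iN|].
      by rewrite a0 ?mul0r.
    exact: cos_series_cvg.
  rewrite [X in X @ _ --> _](_ : _ = fun=> 0); first exact: cvg_cst.
  by apply/funext => i; rewrite seriesE big1 // => l _; rewrite mulr0 mul0r addr0.
- by move=> x _; rewrite chebsum_hc_denom cexp_cis.
- move=> x /andP[x0 x1] h.
  have x11 : -1 <= x <= 1 by apply/andP; split; lra.
  have hE : h = laplace_integrand g lam m n (acos x).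
    apply/funext => t; rewrite /h /laplace_integrand sin_acos // acosK //.
  have cx : 0 < cos (acos x) by rewrite acosK.
  (* For [0 < x] the ray lies in the open right half-plane, where the Laplace integral converges. *)
  have hth : 0 <= acos x < pi / 2.
    rewrite acos_ge0 //=; have pi0 := pi_gt0 R.
    rewrite -ltr_cos ?cos_pihalf // in_itv /=; apply/andP; split; rewrite ?acos_ge0 ?acos_lepi //; lra.
  rewrite hE; split; first by have [] := laplace_integral lam m ng1 cx.
  have G0 : 0 < Gamma ((n + mtot m)%:R + g).
    have a0 : 0 < n%:R + g - 1 + (mtot m)%:R by rewrite ltr_wpDr // subr_gt0.
    have := Gamma_gt0 a0; have -> // : n%:R + g - 1 + (mtot m)%:R + 1 = (n + mtot m)%:R + g.
    by rewrite natrD; ring.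
  rewrite laplace_denominator // mulrA -rmorphM /= mulVf ?expf_neq0 ?gt_eqF // mul1r.
  by rewrite chebsum_hc_denom sqr_normc.
- move=> lam0 lam_mono.
  have [j0 mj0] := m_neq0.
  (* As [lam] increases with the index, the least index with [m j != 0] gives the smallest node that
     occurs. *)
  have [j mj jmin] := @arg_minnP _ j0 (fun j => m j != 0%N) (fun j => j : nat) mj0.
  exists j; apply: not_linear => // p mp.
  have := jmin p mp; rewrite leq_eqVlt => /orP[/eqP/val_inj -> //|jp].
  exact/ltW/lam_mono.
Qed.
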